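(* The problem \textsc{Secluded $s$-$t$-Separator} can be solved in polynomial time.
   Context: \textsc{Secluded $s$-$t$-Separator}: given an undirected graph $G=(V,E)$, two distinct vertices $s,t\in V$, and an integer $k$, decide whether there is a set $S\subseteq V\setminus\{s,t\}$ such that $G-S$ contains no $s$-$t$ path and $|N_G[S]|\le k$, where $N_G[S]=S\cup\bigcup_{v\in S}N_G(v)$ is the closed neighborhood of $S$. *)

(* Defs.v *)
From mathcomp Require Import all_boot.
Set Implicit Arguments. Unset Strict Implicit. Unset Printing Implicit Defensive.

Definition closed_nbhd n (e : rel 'I_n) (S : {set 'I_n}) : {set 'I_n} :=
  S :|: [set v | [exists u in S, e u v]].

(* the graph G - S, as an adjacency relation on 'I_n in which the vertices
   of S are isolated (they are never endpoints of an edge) *)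
Definition del_rel n (e : rel 'I_n) (S : {set 'I_n}) : rel 'I_n :=
  [rel u v | [&& e u v, u \notin S & v \notin S]].

Definition secluded_st_separator n (e : rel 'I_n) (s t : 'I_n) (k : nat) : Prop :=
  exists S : {set 'I_n},
    [/\ s \notin S, t \notin S,
        ~~ connect (del_rel e S) s t
      & #|closed_nbhd e S| <= k].

(* Machine model: a random-access machine with the logarithmic cost   *)
(* criterion (polynomially equivalent to Turing machines).            *)

Inductive instr : Type :=
| IConst of nat & nat
| IAdd of nat & nat & nat
| ISub of nat & nat & nat    (* ISub r a b   : R[r] := R[a] - R[b] (truncated) *)
| ILoad of nat & nat
| IStore of nat & nat
| IJz of nat & nat
| IJmp of nat
| IHalt.                     (* halt (also: pc outside the program)   *)

Definition program := seq instr.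

Definition bitlen (v : nat) : nat := (Nat.log2 v).+1.

Definition upd (m : nat -> nat) (a v : nat) : nat -> nat :=
  fun x => if x == a then v else m x.

Definition step (p : program) (pc : nat) (m : nat -> nat)
  : option (nat * (nat -> nat) * nat) :=
  match nth IHalt p pc with
  | IConst r c => Some (pc.+1, upd m r c, 1 + bitlen r + bitlen c)
  | IAdd r a b => Some (pc.+1, upd m r (m a + m b),
                        1 + bitlen r + bitlen a + bitlen b + bitlen (m a) + bitlen (m b))
  | ISub r a b => Some (pc.+1, upd m r (m a - m b),
                        1 + bitlen r + bitlen a + bitlen b + bitlen (m a) + bitlen (m b))
  | ILoad r a => Some (pc.+1, upd m r (m (m a)),
                       1 + bitlen r + bitlen a + bitlen (m a) + bitlen (m (m a)))
  | IStore a b => Some (pc.+1, upd m (m a) (m b),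
                        1 + bitlen a + bitlen (m a) + bitlen b + bitlen (m b))
  | IJz a l => Some (if m a == 0 then l else pc.+1, m, 1 + bitlen a + bitlen (m a) + bitlen l)
  | IJmp l => Some (l, m, 1 + bitlen l)
  | IHalt => None
  end.

Fixpoint run (p : program) (fuel pc : nat) (m : nat -> nat)
  : option ((nat -> nat) * nat) :=
  match step p pc m with
  | None => Some (m, 0)
  | Some (pc', m', c) =>
      match fuel with
      | 0 => None
      | fuel'.+1 =>
          match run p fuel' pc' m' with
          | Some (m'', c') => Some (m'', c + c')
          | None => None
          end
      end
  end.

(*   R[4 + i*n + j] = 1 if ij is an edge, 0 otherwise (i, j < n),      *)

Definition encode n (e : rel 'I_n) (s t : 'I_n) (k : nat) : nat -> nat :=
  fun x =>
    if x == 0 then n else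
    if x == 1 then nat_of_ord s else
    if x == 2 then nat_of_ord t else
    if x == 3 then k else
    if (4 <= x) && (x < 4 + n * n) then
      (match insub ((x - 4) %/ n), insub ((x - 4) %% n) with
       | Some i, Some j => nat_of_bool (e i j)
       | _, _ => 0
       end)
    else 0.

Definition input_size n (s t : 'I_n) (k : nat) : nat :=
  n * n + bitlen n + bitlen s + bitlen t + bitlen k.

Definition decides_secluded_in_poly_time (p : program) (c d : nat) : Prop :=
  forall n (e : rel 'I_n), symmetric e -> irreflexive e ->
  forall (s t : 'I_n), s != t -> forall k : nat,
  exists fuel m' cost,
    [/\ run p fuel 0 (encode e s t k) = Some (m', cost),
        cost <= c * (input_size s t k).+1 ^ d
      & (m' 0 = 1 <-> secluded_st_separator e s t k)].

(* Main.v *)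
Require Import Defs.
From mathcomp Require Import all_boot.
From mathcomp Require Import zify.
From Stdlib Require PeanoNat.
Set Implicit Arguments. Unset Strict Implicit. Unset Printing Implicit Defensive.

(* Minimizing |N[S]| is a minimum vertex cut problem. Pay for the vertices of P = N[S].
   A vertex v can be put in S at no further cost iff N[v] is contained in P, so a walk
   survives iff each of its inner vertices has an unpaid vertex in its closed neighbourhood.
   Hence, for nonadjacent s and t, P must separate the ball of radius 2 around s from the
   ball of radius 2 around t in the cube of G. Splitting each vertex u into a left copy
   (unless u is near t) and a right copy (unless u is near s), with left u joined to right
   v when dist(u, v) <= 3, a pair (L, R) consisting of a vertex cover together with the
   deleted copies corresponds to the separator P = L :&: R with |P| = |L| + |R| - n, so
   that König's theorem reduces the problem to maximum bipartite matching.
     The matching is found by an auction: an unmatched left vertex takes its cheapest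
   neighbour if that costs at most n, evicts the previous owner and raises the price by
   one. Prices never exceed n + 1, so n * (n + 1) steps suffice.
     On the machine, one step lengthens the binary representation of the largest number
   by at most one bit, so a polynomial bound on the number of steps bounds the logarithmic
   cost as well. *)

(** * Execution and cost *)

(** Execution without cost accounting, so that code fragments can be chained freely; [run_of_stepn]
    recovers the cost at the end. *)
Fixpoint stepn (p : program) (t pc : nat) (m : nat -> nat) :
  option (nat * (nat -> nat)) :=
  if t is t'.+1 then
    if step p pc m is Some (pc', m', _) then stepn p t' pc' m' else None
  else Some (pc, m).

Lemma stepn_trans p t1 t2 pc m pc1 m1 r :
  stepn p t1 pc m = Some (pc1, m1) -> stepn p t2 pc1 m1 = r ->
  stepn p (t1 + t2) pc m = r.
Proof.
elim: t1 pc m => [|t IH] pc m /=; first by case=> -> ->.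
by case: (step p pc m) => [[[pc' m'] c]|] // /IH; apply.
Qed.

Definition instr_bits (i : instr) : nat :=
  match i with
  | IConst a b | ILoad a b | IStore a b | IJz a b => bitlen a + bitlen b
  | IAdd a b c | ISub a b c => bitlen a + bitlen b + bitlen c
  | IJmp a => bitlen a
  | IHalt => 0
  end.

Definition prog_bits (p : program) : nat := sumn (map instr_bits p).

Lemma prog_bitsP p i : instr_bits (nth IHalt p i) <= prog_bits p.
Proof.
rewrite /prog_bits; elim: p i => [|x p IH] [|i] //=; first exact: leq_addr.
by apply: leq_trans (IH i) (leq_addl _ _).
Qed.

Lemma bitlen_le a b : a <= b -> bitlen a <= bitlen b.
Proof. by rewrite /bitlen => ab; have := PeanoNat.Nat.log2_le_mono a b; lia. Qed.

Lemma bitlen_add a b w : bitlen a <= w -> bitlen b <= w -> bitlen (a + b) <= w.+1.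
Proof.
wlog ab : a b / a <= b => [hw|] ha hb.
  by case/orP: (leq_total a b) => h; [|rewrite addnC]; apply: hw.
have [b0|b0] := posnP b.
  by have -> : a + b = b by [lia]; rewrite leqW.
have : bitlen (a + b) <= bitlen (2 * b) by apply: bitlen_le; lia.
rewrite {2}/bitlen PeanoNat.Nat.log2_double; last by lia.
by move: hb; rewrite /bitlen; lia.
Qed.

(** Only an addition can produce a number longer than [w], and by one bit at most. An instruction
    pays for its literals, bounded by [prog_bits], and for at most two stored values, whence
    [3 * w + 1]. *)
Lemma step_bits p pc m pc' m' c w :
  prog_bits p <= w -> (forall x, bitlen (m x) <= w) ->
  step p pc m = Some (pc', m', c) ->
  c <= 3 * w + 1 /\ forall x, bitlen (m' x) <= w.+1.
Proof.
move=> hp hm; have := prog_bitsP p pc; rewrite /step.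
have upds a v x : bitlen v <= w.+1 -> bitlen (upd m a v x) <= w.+1.
  by rewrite /upd; case: ifP => // _ _; exact: leqW.
case: (nth _ _ _) => //= *; repeat match goal with
  | H : Some _ = Some _ |- _ => case: H => *; subst end;
  (split; [repeat match goal with |- context [bitlen (?f ?x)] => 
     lazymatch goal with _ : is_true (bitlen (f x) <= w) |- _ => fail
      | _ => have := hm x; move=> ? end end; try lia | move=> x; try apply: upds]);
  try exact: leqW (hm _).
- by apply: leq_trans (leqW hp); lia.
- by apply: bitlen_add.
- by apply: leq_trans (bitlen_le (leq_subr _ _)) (leqW (hm _)).
Qed.

Lemma run_of_stepn p t pc m pc' m' w :
  prog_bits p <= w -> (forall x, bitlen (m x) <= w) ->
  stepn p t pc m = Some (pc', m') -> step p pc' m' = None ->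
  exists2 cost, run p t pc m = Some (m', cost) & cost <= t * (3 * (w + t) + 1).
Proof.
move=> hp hm h hend; elim: t pc m w hp hm h => [|t IH] pc m w hp hm /=.
  by case=> -> ->; rewrite hend; exists 0.
case E : (step p pc m) => [[[pc1 m1] c]|] // h.
have [hc hm1] := step_bits hp hm E.
have [cost -> hcost] := IH _ _ w.+1 (leqW hp) hm1 h.
by exists (c + cost) => //; nia.
Qed.

Definition embedded (p : program) (a : nat) (code : seq instr) : Prop :=
  forall i, i < size code -> nth IHalt p (a + i) = nth IHalt code i.

Lemma embedded_cat p a c1 c2 :
  embedded p a (c1 ++ c2) -> embedded p a c1 /\ embedded p (a + size c1) c2.
Proof.
move=> h; split=> i hi.
  by rewrite h ?nth_cat ?hi // size_cat ltn_addr.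
by rewrite -addnA h ?nth_cat ?size_cat ?ltn_add2l // ltnNge leq_addr /= addKn.
Qed.

Lemma embedded_cons p a i c :
  embedded p a (i :: c) -> nth IHalt p a = i /\ embedded p a.+1 c.
Proof.
move=> h; split; first by rewrite -[a]addn0 (h 0).
by move=> j hj; rewrite addSnnS (h j.+1).
Qed.

(** * A loop language and its compiler *)

(** There is no unbounded loop, so the shape of a command alone yields a polynomial running time. *)
Inductive cmd : Type :=
| CSkip
| CConst of nat & nat
| CAdd of nat & nat & nat
| CSub of nat & nat & nat
| CLoad of nat & nat & nat
| CStore of nat & nat & nat
| CSeq of cmd & cmd
| CIf of nat & cmd & cmd
| CFor of nat & cmd.

Record state := State { vars : nat -> nat; arrs : nat -> nat -> nat }.

Definition set_var (s : state) r v := State (upd (vars s) r v) (arrs s).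
Definition set_arr (s : state) id i v :=
  State (vars s) (fun id' => if id' == id then upd (arrs s id) i v else arrs s id').

(* Variable 1 holds the number of iterations of every loop. *)
Fixpoint exec (c : cmd) (s : state) : state :=
  match c with
  | CSkip => s
  | CConst r v => set_var s r v
  | CAdd r a b => set_var s r (vars s a + vars s b)
  | CSub r a b => set_var s r (vars s a - vars s b)
  | CLoad r id a => set_var s r (arrs s id (vars s a))
  | CStore id a b => set_arr s id (vars s a) (vars s b)
  | CSeq c1 c2 => exec c2 (exec c1 s)
  | CIf a c1 c2 => if vars s a == 0 then exec c2 s else exec c1 s
  | CFor i c =>
      set_var (iteri (vars s 1) (fun k s' => exec c (set_var s' i k)) s) i (vars s 1)
  end.

Fixpoint wvars (c : cmd) : seq nat :=
  match c with
  | CConst r _ | CAdd r _ _ | CSub r _ _ | CLoad r _ _ => [:: r]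
  | CSeq c1 c2 | CIf _ c1 c2 => wvars c1 ++ wvars c2
  | CFor i c => i :: wvars c
  | _ => [::]
  end.

Fixpoint warrs (c : cmd) : seq nat :=
  match c with
  | CStore id _ _ => [:: id]
  | CSeq c1 c2 | CIf _ c1 c2 => warrs c1 ++ warrs c2
  | CFor i c => warrs c
  | _ => [::]
  end.

(** Registers 150 to 152 are reserved for compiled code, and eight arrays are interleaved in memory.
    A loop body writes neither its counter nor variable 1, because the compiled loop rereads both at
    every test. *)
Fixpoint wf (c : cmd) : bool :=
  match c with
  | CSkip => true
  | CConst r _ => r < 150
  | CAdd r a b | CSub r a b => [&& r < 150, a < 150 & b < 150]
  | CLoad r id a => [&& r < 150, id < 8 & a < 150]
  | CStore id a b => [&& id < 8, a < 150 & b < 150]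
  | CSeq c1 c2 => wf c1 && wf c2
  | CIf a c1 c2 => [&& a < 150, wf c1 & wf c2]
  | CFor i c => [&& i < 150, i != 1, i \notin wvars c, 1 \notin wvars c & wf c]
  end.

Lemma exec_vars c s r : r \notin wvars c -> vars (exec c s) r = vars s r.
Proof.
elim: c s => //= [r1 v|r1 a b|r1 a b|r1 id a|c1 IH1 c2 IH2|a c1 IH1 c2 IH2|i c IH] s;
  rewrite ?inE /upd.
- by move/negPf->.
- by move/negPf->.
- by move/negPf->.
- by move/negPf->.
- by rewrite mem_cat negb_or => /andP[h1 h2]; rewrite IH2 ?IH1.
- by rewrite mem_cat negb_or => /andP[h1 h2]; case: ifP => _; rewrite ?IH2 ?IH1.
rewrite negb_or => /andP[/negPf h1 h2]; rewrite h1.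
by elim: (vars s 1) => //= k <-; rewrite IH //= /upd h1.
Qed.

Lemma exec_vars_in (rs : seq nat) c st r :
  all (fun x => x \notin wvars c) rs -> r \in rs -> vars (exec c st) r = vars st r.
Proof. by move=> /allP h /h; exact: exec_vars. Qed.

Lemma exec_arrs c s id : id \notin warrs c -> arrs (exec c s) id = arrs s id.
Proof.
elim: c s => //= [id1 a b|c1 IH1 c2 IH2|a c1 IH1 c2 IH2|i c IH] s; rewrite ?inE.
- by move/negPf->.
- by rewrite mem_cat negb_or => /andP[h1 h2]; rewrite IH2 ?IH1.
- by rewrite mem_cat negb_or => /andP[h1 h2]; case: ifP => _; rewrite ?IH2 ?IH1.
by move=> h; elim: (vars s 1) => //= k <-; rewrite IH.
Qed.

(* Cell [x] of array [id] lives at address [200 + 8 * x + id]; register 152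
   holds the constant 1, and 150, 151 are scratch. *)
Definition addr_code id x : seq instr :=
  [:: IAdd 150 x x; IAdd 150 150 150; IAdd 150 150 150; IConst 151 (200 + id);
      IAdd 150 150 151].

(** Code length, computed separately because the absolute jump targets in [compile] depend on it. *)
Fixpoint csize (c : cmd) : nat :=
  match c with
  | CSkip => 0
  | CConst _ _ | CAdd _ _ _ | CSub _ _ _ => 1
  | CLoad _ _ _ | CStore _ _ _ => 6
  | CSeq c1 c2 => csize c1 + csize c2
  | CIf _ c1 c2 => (csize c1 + (csize c2).+1).+1
  | CFor _ c => (csize c + 2).+3
  end.

Fixpoint compile (c : cmd) (a : nat) : seq instr :=
  match c with
  | CSkip => [::]
  | CConst r v => [:: IConst r v]
  | CAdd r x y => [:: IAdd r x y]
  | CSub r x y => [:: ISub r x y]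
  | CLoad r id x => addr_code id x ++ [:: ILoad r 150]
  | CStore id x y => addr_code id x ++ [:: IStore 150 y]
  | CSeq c1 c2 => compile c1 a ++ compile c2 (a + csize c1)
  | CIf r c1 c2 =>
      IJz r (a.+1 + csize c1).+1 ::
      compile c1 a.+1 ++
      IJmp ((a.+1 + csize c1).+1 + csize c2) :: compile c2 (a.+1 + csize c1).+1
  | CFor i c =>
      [:: IConst i 0, ISub 150 1 i, IJz 150 (a.+3 + csize c).+2 & compile c a.+3] ++
      [:: IAdd i i 152; IJmp a.+1]
  end.

Lemma size_compile c a : size (compile c a) = csize c.
Proof.
elim: c a => //= [c1 IH1 c2 IH2|r c1 IH1 c2 IH2|i c IH] a;
  by rewrite size_cat ?IH1 ?IH2 /= ?IH2 ?IH.
Qed.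

(** Both branches of a conditional are charged, so that the bound depends on [n] only. *)
Fixpoint time (c : cmd) (n : nat) : nat :=
  match c with
  | CSkip => 0
  | CConst _ _ | CAdd _ _ _ | CSub _ _ _ => 1
  | CLoad _ _ _ | CStore _ _ _ => 6
  | CSeq c1 c2 => time c1 n + time c2 n
  | CIf _ c1 c2 => time c1 n + time c2 n + 2
  | CFor _ c => n * (time c n + 4) + 3
  end.

Lemma time_poly c : exists K d, forall n, time c n <= K * n.+1 ^ d.
Proof.
have mono n a b : a <= b -> n.+1 ^ a <= n.+1 ^ b by move=> ?; rewrite leq_pexp2l.
elim: c => /= [|||||||_ c1 [K1 [d1 h1]] c2 [K2 [d2 h2]]|_ c [K [d h]]];
  try by move=> *; exists 6, 0 => n; rewrite expn0.
- move=> c1 [K1 [d1 h1]] c2 [K2 [d2 h2]]; exists (K1 + K2), (d1 + d2) => n.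
  rewrite mulnDl leq_add //.
    by apply: leq_trans (h1 n) _; rewrite leq_mul2l mono ?orbT ?leq_addr.
  by apply: leq_trans (h2 n) _; rewrite leq_mul2l mono ?orbT ?leq_addl.
- exists (K1 + K2 + 2), (d1 + d2) => n; rewrite !mulnDl.
  rewrite !leq_add //.
  + by apply: leq_trans (h1 n) _; rewrite leq_mul2l mono ?orbT ?leq_addr.
  + by apply: leq_trans (h2 n) _; rewrite leq_mul2l mono ?orbT ?leq_addl.
  + by rewrite leq_pmulr ?expn_gt0.
- exists (K + 7), d.+1 => n; have := h n; rewrite expnS.
  have : 0 < n.+1 ^ d by rewrite expn_gt0.
  move: (n.+1 ^ d) => X ? ?; nia.
Qed.

Definition sim (s : state) (m : nat -> nat) : Prop :=
  [/\ forall r, r < 150 -> m r = vars s r,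
      forall id x, id < 8 -> m (200 + 8 * x + id) = arrs s id x
    & m 152 = 1].

Lemma sim_set_var s m r v : r < 150 -> sim s m -> sim (set_var s r v) (upd m r v).
Proof.
move=> hr [h1 h2 h3]; split=> [x hx|id x hid|]; rewrite /= /upd.
- by case: ifP => // _; exact: h1.
- by case: eqP => [|_]; [lia|exact: h2].
- by case: eqP => //; lia.
Qed.

Lemma sim_scratch s m r v : (r == 150) || (r == 151) -> sim s m -> sim s (upd m r v).
Proof.
move=> hr [h1 h2 h3]; split=> [x hx|id x hid|]; rewrite /= /upd.
- by case: eqP => [|_]; [lia|exact: h1].
- by case: eqP => [|_]; [lia|exact: h2].
- by case: eqP => //; lia.
Qed.

(** No other cell is hit: [id < 8] makes the address determine [x] and [id], and array addresses lie
    above all registers. *)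
Lemma sim_set_arr s m id x v : id < 8 ->
  sim s m -> sim (set_arr s id x v) (upd m (200 + 8 * x + id) v).
Proof.
move=> hid [h1 h2 h3]; split=> [y hy|id' y hid'|]; rewrite /= /upd.
- by case: eqP => [|_]; [lia|exact: h1].
- case: eqP => [e|ne]; case: eqP => [e2|ne2].
  + by case: eqP => //; lia.
  + by lia.
  + by case: eqP => [|_]; [lia|rewrite h2 // e2].
  + exact: h2.
- by case: eqP => //; lia.
Qed.

Lemma addr_codeP p a s m id x :
  embedded p a (addr_code id x) -> x < 150 -> id < 8 -> sim s m ->
  exists m', [/\ stepn p 5 a m = Some (a + 5, m'), sim s m'
    & m' 150 = 200 + 8 * vars s x + id].
Proof.
rewrite /addr_code => h hx hid hs.
move: h => /embedded_cons[i0] /embedded_cons[i1] /embedded_cons[i2].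
move=> /embedded_cons[i3] /embedded_cons[i4 _].
eexists; split; first by rewrite /= /step i0 /= i1 /= i2 /= i3 /= i4 /= !addnS addn0.
  by do 5 (apply: sim_scratch => //).
by rewrite /upd /=; case: hs => e _ _; rewrite (e x hx); lia.
Qed.

Lemma compileP c p a s m : wf c -> 1 \notin wvars c ->
  embedded p a (compile c a) -> sim s m ->
  exists t m', [/\ t <= time c (vars s 1),
    stepn p t a m = Some (a + csize c, m') & sim (exec c s) m'].
Proof.
elim: c p a s m => /= [|r v|r x y|r x y|r id x|id x y|c1 IH1 c2 IH2
                      |r c1 IH1 c2 IH2|i c IH] p a s m.
- by move=> _ _ _ hs; exists 0, m; rewrite addn0.
- move=> hr _ /embedded_cons[h _] hs; exists 1, (upd m r v).
  by rewrite /= /step h addn1; split=> //; exact: sim_set_var.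
- case/and3P=> hr hx hy _ /embedded_cons[h _] hs.
  exists 1, (upd m r (m x + m y)); rewrite /= /step h addn1; split=> //.
  by case: (hs) => e _ _; rewrite !e //; exact: sim_set_var.
- case/and3P=> hr hx hy _ /embedded_cons[h _] hs.
  exists 1, (upd m r (m x - m y)); rewrite /= /step h addn1; split=> //.
  by case: (hs) => e _ _; rewrite !e //; exact: sim_set_var.
- case/and3P=> hr hid hx _.
  rewrite -[_ :: _]/(addr_code id x ++ [:: ILoad r 150]) => /embedded_cat[h1 /embedded_cons[h2 _]] hs.
  have [m1 [e1 s1 v1]] := addr_codeP h1 hx hid hs.
  exists 6, (upd m1 r (m1 (m1 150))); split=> //.
    by rewrite (stepn_trans (t1 := 5) (t2 := 1) e1 erefl) /= /step h2 !addnS.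
  by rewrite v1; case: (s1) => _ e _; rewrite e //; exact: sim_set_var.
- case/and3P=> hid hx hy _.
  rewrite -[_ :: _]/(addr_code id x ++ [:: IStore 150 y]) => /embedded_cat[h1 /embedded_cons[h2 _]] hs.
  have [m1 [e1 s1 v1]] := addr_codeP h1 hx hid hs.
  exists 6, (upd m1 (m1 150) (m1 y)); split=> //.
    by rewrite (stepn_trans (t1 := 5) (t2 := 1) e1 erefl) /= /step h2 !addnS.
  by rewrite v1; case: (s1) => e _ _; rewrite (e y hy); exact: sim_set_arr.
- case/andP=> w1 w2; rewrite mem_cat negb_or => /andP[n1 n2].
  move=> /embedded_cat[]; rewrite size_compile => h1 h2 hs.
  have [t1 [m1 [le1 e1 s1]]] := IH1 _ _ _ _ w1 n1 h1 hs.
  have [t2 [m2 [le2 e2 s2]]] := IH2 _ _ _ _ w2 n2 h2 s1.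
  exists (t1 + t2), m2; split=> //; last by rewrite (stepn_trans e1 e2) addnA.
  by rewrite exec_vars // in le2; rewrite leq_add.
- case/and3P=> hr w1 w2; rewrite mem_cat negb_or => /andP[n1 n2].
  case/embedded_cons=> i1 /embedded_cat[]; rewrite size_compile => h1.
  case/embedded_cons=> i2 h2 hs.
  have er : m r = vars s r by case: (hs) => e _ _; exact: e.
  have [z|nz] := boolP (vars s r == 0).
    have [t [m1 [le1 e1 s1]]] := IH2 _ _ _ _ w2 n2 h2 hs.
    exists t.+1, m1; split=> //; first by lia.
    by rewrite /= /step i1 er z e1; congr (Some (_, _)); lia.
  have [t [m1 [le1 e1 s1]]] := IH1 _ _ _ _ w1 n1 h1 hs.
  exists (t.+1 + 1), m1; split=> //; first by lia.
  apply: (@stepn_trans _ t.+1 1 _ _ (a.+1 + csize c1) m1) => /=.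
    by rewrite {1}/step i1 er (negPf nz); exact: e1.
  by rewrite /step i2; congr (Some (_, _)); lia.
case/and5P=> hi i1 ni n1 wc _.
case/embedded_cons=> i_0 /embedded_cons[i_1] /embedded_cons[i_2].
case/embedded_cat; rewrite size_compile => hc /embedded_cons[i_3] /embedded_cons[i_4 _] hs.
set N := vars s 1.
pose S k := iteri k (fun k s' => exec c (set_var s' i k)) s.
have S1 k : vars (S k) 1 = N.
  by elim: k => //= k IHk; rewrite exec_vars //= /upd ifN // eq_sym.
(* Execution stands at the test of round [k]. A round takes two steps for the test, the body, and
   two for increment and jump. *)
have loop k : k <= N -> exists t m', [/\ t <= k * (time c N + 4) + 1,
    stepn p t a m = Some (a.+1, m') & sim (set_var (S k) i k) m'].
  elim: k => [|k IHk] hk.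
    exists 1, (upd m i 0); split=> //; first by rewrite /= /step i_0.
    exact: sim_set_var.
  have [t [m1 [le1 e1 s1]]] := IHk (ltnW hk).
  have s1' := sim_scratch (N - k) (isT : (150 == 150) || (150 == 151)) s1.
  have [t2 [m2 [le2 e2 s2]]] := IH _ _ _ _ wc n1 hc s1'.
  have v1 : vars (set_var (S k) i k) 1 = N by rewrite /= /upd eq_sym (negPf i1) S1.
  have vi : vars (set_var (S k) i k) i = k by rewrite /= /upd eqxx.
  have vi' : vars (S k.+1) i = k by rewrite /= exec_vars.
  exists (t + (2 + (t2 + 2))), (upd m2 i k.+1); split.
  - by rewrite v1 in le2; lia.
  - apply: (stepn_trans e1).
    apply: (@stepn_trans _ 2 _ _ _ a.+3 (upd m1 150 (N - k))).
      rewrite /= /step i_1 /= i_2 /= {1}/upd eqxx.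
      case: (s1) => e _ _; rewrite !e //.
      by rewrite v1 vi subn_eq0 leqNgt hk.
    apply: (stepn_trans e2); rewrite /= /step i_3 /= i_4 /=.
    by case: (s2) => e _ ->; rewrite (e i hi) vi' addn1.
  - by apply: sim_set_var.
have [t [m1 [le1 e1 s1]]] := loop N (leqnn N).
exists (t + 2), (upd m1 150 0); split=> //.
- by lia.
- apply: (stepn_trans e1); rewrite /= /step i_1 /= i_2 /=.
  have v1 : vars (set_var (S N) i N) 1 = N by rewrite /= /upd eq_sym (negPf i1) S1.
  have vi : vars (set_var (S N) i N) i = N by rewrite /= /upd eqxx.
  case: (s1) => e _ _; rewrite !e // v1 vi subnn /upd eqxx.
  by congr (Some (_, _)); lia.
- by apply: sim_scratch.
Qed.

(** * Moving the input out of the way of the registers *)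

Definition prologue : program :=
  [:: (* cells n+5 = e(1,1) and n+4 = e(1,0) are redundant: they hold k and s *)
      IConst 4 5; IAdd 4 4 0; IStore 4 3; IConst 3 1; ISub 4 4 3; IStore 4 1;
      IConst 4 0; IConst 1 0; IAdd 3 0 1; IConst 1 1;
      (* 10: R4 := n * n *)
      IJz 3 14; IAdd 4 4 0; ISub 3 3 1; IJmp 10;
      (* 14: n, t, k, s go to the addresses from 200 + 8 * n * n on *)
      IAdd 1 4 4; IAdd 1 1 1; IAdd 1 1 1; IConst 3 200; IAdd 1 1 3; IStore 1 0;
      IConst 3 1; IAdd 1 1 3; IStore 1 2;
      IConst 2 5; IAdd 2 2 0; ILoad 2 2; IAdd 1 1 3; IStore 1 2;
      IConst 2 4; IAdd 2 2 0; IAdd 1 1 3; ILoad 3 2; IStore 1 3; IStore 2 5;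
      IConst 0 0; IAdd 0 0 4;
      (* 36: the matrix cells 4 + x go to 200 + 8 * x, for decreasing x *)
      IJz 0 49; IConst 1 1; ISub 0 0 1; IConst 1 4; IAdd 1 1 0; ILoad 2 1;
      IAdd 1 0 0; IAdd 1 1 1; IAdd 1 1 1; IConst 3 200; IAdd 1 1 3; IStore 1 2;
      IJmp 36;
      IAdd 5 4 4; IAdd 5 5 5; IAdd 5 5 5; IConst 6 200; IAdd 5 5 6; IConst 152 1;
      ILoad 1 5; IAdd 5 5 152; ILoad 3 5; IAdd 5 5 152; ILoad 4 5; IAdd 5 5 152;
      ILoad 2 5].

(** Replaces the address and value of each write by given closed forms, which keeps the memory
    readable during symbolic execution. *)
Lemma stepn_upd p t pc m a v pc' a' v' c r :
  step p pc m = Some (pc', upd m a' v', c) -> a' = a -> v' = v ->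
  stepn p t pc' (upd m a v) = r -> stepn p t.+1 pc m = r.
Proof. by move=> /= -> -> ->. Qed.

Ltac upd_lia := rewrite ?/upd /=; try lia; repeat (case: eqP => ?; try lia).
Ltac write_step a v :=
  apply: (@stepn_upd _ _ _ _ a v); [reflexivity | by upd_lia | by upd_lia |].

Lemma prologue_square rest m q : m 1 = 1 -> q <= m 3 ->
  exists m', [/\ stepn (prologue ++ rest) (q * 4) 10 m = Some (10, m'),
    m' 3 = m 3 - q, m' 4 = m 4 + q * m 0
    & forall x, x <> 3 -> x <> 4 -> m' x = m x].
Proof.
move=> m1; elim: q => [|q IH] hq.
  by exists m; rewrite subn0 addn0.
have [m' [e e3 e4 e0]] := IH (ltnW hq).
exists (upd (upd m' 4 (m' 4 + m' 0)) 3 (m' 3 - m' 1)); split.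
- rewrite mulSn addnC; apply: (stepn_trans e).
  rewrite /= /step /= ifN /=; last by rewrite e3; lia.
  by [].
- by rewrite /upd /= e3 e0 // m1; lia.
- by rewrite /upd /= e4 e0 //; lia.
- by move=> x h3 h4; upd_lia; rewrite e0.
Qed.

(** Source and target overlap. Going downwards is safe, since [200 + 8 * x] lies above every cell
    still to be read; values parked from [200 + 8 * m 4] on lie beyond all targets. *)
Lemma prologue_copy rest m q : m 0 = m 4 -> q <= m 4 ->
  exists m', [/\ stepn (prologue ++ rest) (q * 13) 36 m = Some (36, m'),
    m' 0 = m 4 - q,
    forall x, 4 <= x -> x < 4 + (m 4 - q) \/ 200 + 8 * m 4 <= x -> m' x = m x,
    m' 4 = m 4
    & forall x, m 4 - q <= x -> x < m 4 -> m' (200 + 8 * x) = m (4 + x)].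
Proof.
move=> m04; elim: q => [|q IH] hq.
  by exists m; rewrite subn0; split=> // x; lia.
have [m' [e e0 es e4 ed]] := IH (ltnW hq).
have ne0 : m' 0 != 0 by rewrite e0; lia.
have esrc : m' (4 + (m 4 - q - 1)) = m (4 + (m 4 - q - 1)) by apply: es; lia.
eexists; split.
- rewrite mulSn addnC; apply: (stepn_trans e).
  by rewrite /= /step /= ifN.
- by rewrite /= /upd /= e0; upd_lia.
- by move=> x h4 hx; rewrite /= /upd /= e0; upd_lia; apply: es; lia.
- by rewrite /= /upd /= e0; upd_lia.
- move=> x h1 h2; rewrite /= /upd /= e0 esrc.
  by upd_lia; [congr m; lia | apply: ed; lia].
Qed.

Lemma encode_cell n (e : rel 'I_n) s t k (i j : 'I_n) :
  encode e s t k (4 + (i * n + j)) = e i j.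
Proof.
have hi := ltn_ord i; have hj := ltn_ord j; have n0 : 0 < n by lia.
rewrite /encode /= ifT; last by nia.
rewrite addKn divnMDl // divn_small // addn0 modnMDl modn_small //.
by rewrite !valK.
Qed.

(** The input leaves no low register free, so working space is taken from redundant cells: the
    diagonal entries (0,0) and (1,1), and (1,0), which symmetry recovers from (0,1). Hence only
    off-diagonal entries are guaranteed afterwards. *)
Lemma prologueP rest n (e : rel 'I_n) (s t : 'I_n) k : symmetric e -> s != t ->
  exists T m', [/\ T <= 13 * (n * n) + 4 * n + 100,
    stepn (prologue ++ rest) T 0 (encode e s t k) = Some (62, m'),
    [/\ m' 152 = 1, m' 1 = n, m' 2 = s, m' 3 = t & m' 4 = k]
    & forall i j : 'I_n, i != j -> m' (200 + 8 * (i * n + j)) = e i j].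
Proof.
move=> e_sym st; have n2 : 1 < n.
  by move: st; rewrite -val_eqE /=; have := ltn_ord s; have := ltn_ord t; lia.
have cell := encode_cell e s t k; set m0 := encode e s t k in cell *.
have [i0 i1 i2 i3] : [/\ m0 0 = n, m0 1 = s, m0 2 = t & m0 3 = k] by [].
clearbody m0; have nn : n + 2 <= n * n + 2 by nia.
have [m1 [e1 [a0 a1 a2 a3 a4] as_ ak am]] : exists m1,
  [/\ stepn (prologue ++ rest) 10 0 m0 = Some (10, m1),
   [/\ m1 0 = n, m1 1 = 1, m1 2 = t, m1 3 = n & m1 4 = 0], m1 (n + 4) = s, m1 (n + 5) = k
   & forall x, 5 <= x -> x <> n + 4 -> x <> n + 5 -> m1 x = m0 x].
  eexists; split.
  - write_step 4 5; write_step 4 (n + 5); write_step (n + 5) k; write_step 3 1.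
    write_step 4 (n + 4); write_step (n + 4) s; write_step 4 0; write_step 1 0.
    by write_step 3 n; write_step 1 1.
  - by split; upd_lia.
  - by upd_lia.
  - by upd_lia.
  - by move=> x h1 h2 h3; upd_lia.
have [m2 [e2 b3 b4 bm]] := prologue_square rest a1 (leqnn (m1 3)).
rewrite a3 a4 a0 add0n in e2 b3 b4.
have [m3 [e3 c0 c4 cm [cn ct ck cs]]] : exists m3,
  [/\ stepn (prologue ++ rest) 22 14 m2 = Some (36, m3),
    m3 0 = n * n, m3 4 = n * n,
    forall x, 5 <= x -> x <> n + 5 -> x < 4 + n * n -> m3 x = m0 x
   & [/\ m3 (200 + 8 * (n * n)) = n, m3 (200 + 8 * (n * n) + 1) = t,
       m3 (200 + 8 * (n * n) + 2) = k & m3 (200 + 8 * (n * n) + 3) = s ] ].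
  have r0 : m2 0 = n by rewrite bm.
  have r2 : m2 2 = t by rewrite bm.
  have rk : m2 (5 + n) = k by rewrite bm; [rewrite addnC| lia| lia].
  have rs : m2 (4 + n) = s by rewrite bm; [rewrite addnC| lia| lia].
  have r5 : m2 5 = m0 5 by rewrite bm // am //; lia.
  (* Address 5 holds the entry (0,1) and restores the entry (1,0), whose place [n + 4] was lent to
     [s]. *)
  have e54 : m0 5 = m0 (n + 4).
    pose j1 := Ordinal n2; pose j0 := Ordinal (ltnW n2).
    have := cell j0 j1; have := cell j1 j0.
    by rewrite /= mul0n mul1n addn0 (addnC n) e_sym => -> ->.
  have rm x : 5 <= x -> x <> n + 4 -> x <> n + 5 -> m2 x = m0 x.
    by move=> h1 h2 h3; rewrite bm ?am //; lia.
  set X := 200 + 8 * (n * n).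
  have hX : X = 200 + 8 * (n * n) by [].
  clearbody X.
  eexists; split.
  - write_step 1 (2 * (n * n)); write_step 1 (4 * (n * n)); write_step 1 (8 * (n * n)).
    write_step 3 200; write_step 1 X; write_step X n; write_step 3 1.
    write_step 1 (X + 1); write_step (X + 1) t; write_step 2 5; write_step 2 (5 + n).
    write_step 2 k; write_step 1 (X + 2); write_step (X + 2) k; write_step 2 4.
    write_step 2 (4 + n); write_step 1 (X + 3); write_step 3 s; write_step (X + 3) s.
    write_step (4 + n) (m0 5); write_step 0 0; write_step 0 (n * n).
    by [].
  - by upd_lia.
  - by upd_lia.
  - by move=> x h1 h2 h3; upd_lia; first [apply: rm; lia | rewrite e54; congr m0; lia].
  - by split; upd_lia.
have [m4 [e4 d0 dm d4 dc]] := prologue_copy rest (etrans c0 (esym c4)) (leqnn (m3 4)).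
rewrite c4 in e4 d0 dm d4 dc.
have [m5 [e5 [f0 f1 f2 f3 f4] fm]] : exists m5,
  [/\ stepn (prologue ++ rest) 14 36 m4 = Some (62, m5),
   [/\ m5 152 = 1, m5 1 = n, m5 2 = s, m5 3 = t & m5 4 = k]
   & forall x, 200 <= x -> m5 x = m4 x].
  set X := 200 + 8 * (n * n) in cn ct ck cs dm *.
  have hX : X = 200 + 8 * (n * n) by [].
  clearbody X.
  have gn : m4 X = n by rewrite dm; [exact: cn | lia | lia].
  have gt : m4 (X + 1) = t by rewrite dm; [exact: ct | lia | lia].
  have gk : m4 (X + 2) = k by rewrite dm; [exact: ck | lia | lia].
  have gs : m4 (X + 3) = s by rewrite dm; [exact: cs | lia | lia].
  eexists; split.
  - apply: (@stepn_trans _ 1 13 _ _ 49 m4).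
      by rewrite /= /step /= d0 subnn.
    write_step 5 (2 * (n * n)); write_step 5 (4 * (n * n)); write_step 5 (8 * (n * n)).
    write_step 6 200; write_step 5 X; write_step 152 1; write_step 1 n.
    write_step 5 (X + 1); write_step 3 t; write_step 5 (X + 2); write_step 4 k.
    write_step 5 (X + 3).
    write_step 2 s.
    reflexivity.
  - by split; upd_lia.
  - by move=> x hx; upd_lia.
have eloop : stepn (prologue ++ rest) 1 10 m2 = Some (14, m2).
  by rewrite /= /step /= b3 subnn.
exists (10 + (n * 4 + (1 + (22 + (n * n * 13 + 14))))), m5; split; last 1 first.
- move=> i j ij; have hi := ltn_ord i; have hj := ltn_ord j.
  have ijn : i * n + j < n * n by nia.
  have ij0 : 0 < i * n + j by move: ij; rewrite -val_eqE /=; nia.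
  (* [n + 5] is the address of the diagonal entry (1,1), which stays overwritten. *)
  have ij1 : 4 + (i * n + j) <> n + 5.
    by move: ij; rewrite -val_eqE /=; case: (nat_of_ord i) => [|[|z]] /=; nia.
  rewrite fm; last by lia.
  rewrite dc; [|by rewrite subnn; lia|exact: ijn].
  by rewrite cm; [exact: cell | lia | exact: ij1 | lia].
- by lia.
- apply: (stepn_trans e1); apply: (stepn_trans e2); apply: (stepn_trans eloop).
  by apply: (stepn_trans e3); apply: (stepn_trans e4).
- exact: (And5 f0 f1 f2 f3 f4).
Qed.

Theorem ram_decides (c : cmd) : wf c -> 1 \notin wvars c ->
  (forall n (e : rel 'I_n), symmetric e -> irreflexive e ->
   forall (s t : 'I_n), s != t -> forall (k : nat) (st : state),
   [/\ vars st 1 = n, vars st 2 = s, vars st 3 = t & vars st 4 = k] ->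
   (forall i j : 'I_n, i != j -> arrs st 0 (i * n + j) = e i j) ->
   vars (exec c st) 0 = 1 <-> secluded_st_separator e s t k) ->
  exists (p : program) (a b : nat), decides_secluded_in_poly_time p a b.
Proof.
move=> wc n1 hc; set p := prologue ++ compile c 62.
have [K [d hK]] := time_poly c.
(* With [X] the input size plus one, there are at most [(K + 117) * X ^ d.+1] steps, where 117 = 13
   + 4 + 100 comes from the prologue. The cost per step is linear in that number plus
   [X + prog_bits p], so the total has order [X ^ (d + d + 2)]. *)
exists p, ((K + 117) * (3 * prog_bits p + 3 * (K + 117) + 4)), (d + d + 2).
move=> n e e_sym e_irr s t st k.
have [T [m [hT run1 [m152 m1 m2 m3 m4] mcell]]] :=
  prologueP (compile c 62) k e_sym st.
pose st0 := State m (fun id x => m (200 + 8 * x + id)).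
have emb : embedded p 62 (compile c 62).
  by move=> i hi; rewrite /p nth_cat -[size prologue]/62 ltnNge leq_addr addKn.
have [T' [m' [hT' run2 [sv _ _]]]] : exists T' m', [/\ T' <= time c (vars st0 1),
    stepn p T' 62 m = Some (62 + csize c, m') & sim (exec c st0) m'].
  by apply: compileP.
have stop : step p (62 + csize c) m' = None.
  by rewrite /step nth_default // size_cat size_compile.
set X := (input_size s t k).+1.
have encb x : bitlen (encode e s t k x) <= X + prog_bits p.
  suff : bitlen (encode e s t k x) <= X by lia.
  rewrite /X /input_size /encode; do 4 (case: ifP => _; first by lia).
  have b0 : bitlen 0 = 1 by [].
  have b1 (b : bool) : bitlen b = 1 by case: b.
  case: ifP => _; rewrite ?b0 //; case: insubP => *; rewrite ?b0 //.
  by case: insubP => *; rewrite ?b0 ?b1 //; lia.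
have [cost r_eq hcost] := run_of_stepn (leq_addl _ _) encb (stepn_trans run1 run2) stop.
exists (T + T'), m', cost; split=> //; last first.
  rewrite sv //; apply: hc => // i j ij; by rewrite /= addn0 mcell.
apply: leq_trans hcost _.
have nX : n.+1 <= X.
  by rewrite /X /input_size; have := ltn_ord s; have : 0 < bitlen n by []; nia.
have nnX : n * n <= X by rewrite /X /input_size; lia.
have X0 : 0 < X by [].
have Y0 : 0 < X ^ d by rewrite expn_gt0.
have hT2 : T' <= K * X ^ d.
  apply: leq_trans hT' _; rewrite /= m1; apply: leq_trans (hK n) _.
  by rewrite leq_mul2l; case: (d) => [|d']; rewrite ?expn0 ?leqnn ?leq_exp2r ?nX ?orbT.
rewrite !expnD -[X ^ 2]/(X * X).
move: (X ^ d) (prog_bits p) Y0 hT2 => Y B Y0 hT2.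
clearbody X.
have XY : X <= X * Y by rewrite leq_pmulr.
have YX : Y <= X * Y by rewrite leq_pmull.
have hU : T + T' <= (K + 117) * (X * Y).
  have : K * Y <= K * (X * Y) by rewrite leq_mul2l YX orbT.
  rewrite mulnDl; move: (n * n) nnX hT => nn nnX hT; move: (X * Y) XY => Z XY.
  move: (K * Y) (K * Z) hT2 => u v ? ?; lia.
set Z := X * Y in XY YX hU *.
have Z0 : 0 < Z by rewrite muln_gt0 X0.
have -> : Y * Y * (X * X) = Z * Z by rewrite /Z; nia.
rewrite mulnACA; apply: leq_mul => //.
move: (K + 117) (T + T') hU => A U hU; clearbody Z.
have BZ : B <= B * Z by rewrite leq_pmulr.
lia.
Qed.

(** * Separators, covers and auctions *)

Definition ball1 n (e : rel 'I_n) : rel 'I_n := [rel u v | (u == v) || e u v].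
Definition ball2 n (e : rel 'I_n) : rel 'I_n :=
  [rel u v | [exists x, ball1 e u x && ball1 e x v]].
Definition ball3 n (e : rel 'I_n) : rel 'I_n :=
  [rel u v | [exists x, ball2 e u x && ball1 e x v]].

Definition near n (e : rel 'I_n) (s : 'I_n) : {set 'I_n} := [set v | ball2 e s v].

Definition is_cover n (e : rel 'I_n) (s t : 'I_n) (L R : {set 'I_n}) : Prop :=
  [/\ near e s \subset R, near e t \subset L
    & forall u v, ball3 e u v -> u \notin L -> v \in R].

(** * Secluded separators and covers *)

Lemma ball1_sym n (e : rel 'I_n) : symmetric e -> symmetric (ball1 e).
Proof. by move=> h u v; rewrite /ball1 /= eq_sym h. Qed.

Lemma ball1_refl n (e : rel 'I_n) u : ball1 e u u.
Proof. by rewrite /ball1 /= eqxx. Qed.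

Lemma ball1_edge n (e : rel 'I_n) u v : e u v -> ball1 e u v.
Proof. by rewrite /ball1 /= orbC => ->. Qed.

Lemma ball3_refl n (e : rel 'I_n) u : ball3 e u u.
Proof.
have b1 := ball1_refl e u.
by apply/existsP; exists u; rewrite b1 andbT; apply/existsP; exists u; rewrite b1.
Qed.

Lemma closed_nbhdP n (e : rel 'I_n) (S : {set 'I_n}) v :
  reflect (exists2 u, u \in S & ball1 e u v) (v \in closed_nbhd e S).
Proof.
rewrite !inE; apply: (iffP orP) => [[vS|/existsP[u /andP[uS uv]]]|[u uS /orP[/eqP<-|uv]]].
- by exists v; rewrite // ball1_refl.
- by exists u; rewrite // ball1_edge.
- by left.
- by right; apply/existsP; exists u; rewrite uS.
Qed.

Lemma connect_ball1 n (e : rel 'I_n) (S : {set 'I_n}) s u v :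
  connect (del_rel e S) s u -> ball1 e u v -> u \notin S -> v \notin S ->
  connect (del_rel e S) s v.
Proof.
move=> su /orP[/eqP<- //|uv] uS vS; apply: connect_trans su _.
by apply: connect1; rewrite /del_rel /= uv uS vS.
Qed.

(** Let [Z] be the set of unpaid vertices reachable from [s]; take the complement of [Z] and
    [Z :|: P]. On a walk of length at most three between unpaid vertices every vertex is in the
    closed neighbourhood of an end, hence outside [S], so reachability passes from one end to the
    other. *)
Lemma cover_of_separator n (e : rel 'I_n) s t k :
  symmetric e -> secluded_st_separator e s t k ->
  exists L R, is_cover e s t L R /\ #|L| + #|R| <= k + n.
Proof.
move=> e_sym [S [sS tS /negP nst hk]]; pose C := connect (del_rel e S).
have b1s := ball1_sym e_sym.
pose P := closed_nbhd e S; pose Z := [set u | (u \notin P) && C s u].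
have nP u v : u \notin P -> ball1 e u v -> v \notin S.
  by move=> uP uv; apply: contra uP => vS; apply/closed_nbhdP; exists v; rewrite // b1s.
have self := ball1_refl e.
exists (~: Z), (Z :|: P); split; last first.
  have -> : #|Z :|: P| = #|Z| + #|P|.
    rewrite cardsU; suff -> : Z :&: P = set0 by rewrite cards0 subn0.
    by apply/setP => u; rewrite in_setI in_set0 inE; case: (u \in P); rewrite ?andbF.
  have := cardsC Z; rewrite card_ord -/P in hk *; lia.
split.
- apply/subsetP => u; rewrite inE => /existsP[x /andP[sx xu]].
  rewrite in_setU orbC; case: (boolP (u \in P)) => //= uP; rewrite inE uP /=.
  have xS := nP u x uP; rewrite b1s in xS; move/(_ xu) in xS.
  apply: (connect_ball1 _ xu xS (nP _ _ uP (self u))).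
  exact: (connect_ball1 (connect0 _ _) sx sS xS).
- apply/subsetP => u; rewrite inE => /existsP[x /andP[tx xu]].
  rewrite in_setC inE; apply/negP => /andP[uP su].
  have xS := nP u x uP; rewrite b1s in xS; move/(_ xu) in xS.
  have ux : ball1 e u x by rewrite b1s.
  have xt : ball1 e x t by rewrite b1s.
  apply: nst; apply: (connect_ball1 _ xt xS tS).
  exact: (connect_ball1 su ux (nP _ _ uP (self u)) xS).
move=> u v /existsP[y /andP[/existsP[x /andP[ux xy]] yv]]; rewrite inE negbK.
rewrite inE => /andP[uP su]; rewrite in_setU orbC.
case: (boolP (v \in P)) => //= vP; rewrite inE vP /=.
have xS := nP u x uP ux.
have yS : y \notin S by apply: (nP v); rewrite // b1s.
apply: (connect_ball1 _ yv yS (nP _ _ vP (self v))).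
apply: (connect_ball1 _ xy xS yS).
exact: (connect_ball1 su ux (nP _ _ uP (self u)) xS).
Qed.

(** [S] is chosen as large as the payment [P] permits: all vertices other than [s] and [t] whose
    closed neighbourhood lies in [P]. *)
Lemma separator_of_cover n (e : rel 'I_n) s t k L R :
  symmetric e -> s != t -> ~~ e s t -> is_cover e s t L R ->
  #|L| + #|R| <= k + n -> secluded_st_separator e s t k.
Proof.
move=> e_sym st nst [hA hB hE] hk; have b1s := ball1_sym e_sym.
pose P := L :&: R.
pose S := [set v | [&& v != s, v != t & [forall u, ball1 e v u ==> (u \in P)]]].
have cardP : #|P| <= k.
  (* Reflexivity of [ball3] joins the two copies of a vertex, so one of them is covered; this gives
     [#|P|] as [#|L| + #|R| - n]. *)
  have LR : L :|: R = setT.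
    apply/setP => u; rewrite !inE; case: (boolP (u \in L)) => //= uL.
    exact: hE (ball3_refl e u) uL.
  by have := cardsUI L R; rewrite LR cardsT card_ord /P; lia.
exists S; split.
- by rewrite inE eqxx.
- by rewrite inE eqxx andbF.
- apply/negP => /connectP[q].
  (* Invariant along a surviving walk: past [s], each vertex sees a vertex outside [L] in its closed
     neighbourhood. *)
  pose I v := (v != t) /\ (v = s \/ exists2 u, ball1 e v u & u \notin L).
  suff key q' v : I v -> path (del_rel e S) v q' -> I (last v q').
    move=> hq ht; have [] : I (last s q) by apply: key hq; split=> //; left.
    by rewrite -ht eqxx.
  elim: q' v => //= w q' IH v [vt hv] /andP[/and3P[vw vS wS] hq]; apply: IH hq.
  (* Otherwise [s] and [t] would be adjacent, or a vertex outside [L] would be within distance two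
     of [t]. *)
  have wt : w != t.
    apply/eqP => wt; rewrite wt in vw; case: hv => [vs|[u vu uL]].
      by rewrite -vs vw in nst.
    have : u \in near e t.
      by rewrite inE; apply/existsP; exists v; rewrite vu andbT ball1_edge // e_sym.
    by move/(subsetP hB); rewrite (negPf uL).
  split=> //; case: (eqVneq w s) => [->|ws]; [by left|right].
  move: wS; rewrite inE ws wt /= negb_forall => /existsP[u].
  rewrite negb_imply => /andP[wu uP]; exists u => //.
  (* The unpaid [u] is within distance two of [s], or ends a walk [x], [v], [w], [u] of length at
     most three with [x] outside [L]. Both put [u] in [R], hence outside [L]. *)
  suff uR : u \in R by apply: contra uP => uL; rewrite inE uL.
  case: hv => [vs|[x vx xL]].
    apply: (subsetP hA); rewrite inE; apply/existsP; exists w.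
    by rewrite wu andbT ball1_edge // -vs.
  apply: hE xL; apply/existsP; exists w; rewrite wu andbT; apply/existsP; exists v.
  by rewrite b1s vx ball1_edge.
- apply: leq_trans cardP; apply: subset_leq_card; apply/subsetP => v.
  case/closed_nbhdP => u; rewrite inE => /and3P[_ _ /forallP/(_ v)/implyP h] uv.
  exact: h.
Qed.

Lemma separator_nonadjacent n (e : rel 'I_n) s t k :
  secluded_st_separator e s t k -> ~~ e s t.
Proof.
move=> [S [sS tS nst _]]; apply: contra nst => st.
by apply: connect1; rewrite /del_rel /= st sS tS.
Qed.

(* [mr v = u.+1] when the right vertex [v] is matched to the left vertex [u],
   and [mr v = 0] when [v] is free; vertices of [near e t] are never matched
   on the left, although [ml] holds for them, those of [near e s] never on the right. *)
Record auction_inv n (e : rel 'I_n) (s t : 'I_n)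
    (ml : 'I_n -> bool) (mr p : 'I_n -> nat) : Prop := AuctionInv {
  inv_match : forall u v, mr v = (nat_of_ord u).+1 ->
    [/\ ml u, u \notin near e t, v \notin near e s & ball3 e u v];
  inv_price : forall u v w, mr v = (nat_of_ord u).+1 -> ball3 e u w -> p v <= (p w).+1;
  inv_inj : forall v w, mr v = mr w -> mr v <> 0 -> v = w;
  inv_left : forall u, ml u -> u \in near e t \/ exists v, mr v = (nat_of_ord u).+1;
  inv_sink : forall u, u \in near e t -> ml u;
  inv_source : forall v, v \in near e s -> p v = n.+1;
  inv_bound : forall v, p v <= n.+1;
  inv_free : forall v, v \notin near e s -> mr v = 0 -> p v = 0;
  inv_range : forall v, mr v <= n
}.

(** * Duality between matchings and covers *)

Definition auction_done n (e : rel 'I_n) (ml : 'I_n -> bool) (p : 'I_n -> nat) : Prop :=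
  forall u v, ~~ ml u -> ball3 e u v -> n.+1 <= p v.

(** Weak duality: a marked left vertex outside [L] is not near [t], so it has a partner, which lies
    in [R] and not near [s]; distinct vertices have distinct partners. *)
Lemma matching_le_cover n (e : rel 'I_n) s t ml mr p L R :
  auction_inv e s t ml mr p -> is_cover e s t L R ->
  #|[set u | ml u]| + #|near e s| <= #|L| + #|R|.
Proof.
move=> inv [hA hB hE]; set M := [set u | ml u].
rewrite -(cardsID L M).
have -> : #|R| = #|R :\: near e s| + #|near e s|.
  by rewrite -(cardsID (near e s) R) (setIidPr hA) addnC.
rewrite addnA leq_add2r; apply: leq_add; first by rewrite subset_leq_card ?subsetIr.
(* The default [u] is never reached on [M :\: L]. *)
pose g u := odflt u [pick v | mr v == (nat_of_ord u).+1].
have gP u : u \in M :\: L -> mr (g u) = (nat_of_ord u).+1.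
  rewrite !inE => /andP[uL uM]; rewrite /g; case: pickP => [v /eqP //|h].
  case: (inv_left inv uM) => [/(subsetP hB)|[v hv]]; first by rewrite (negPf uL).
  by have := h v; rewrite hv eqxx.
rewrite -(@card_in_imset _ _ g); last first.
  by move=> u v /gP hu /gP hv uv; apply: val_inj; rewrite uv hv in hu; case: hu.
apply: subset_leq_card; apply/subsetP => _ /imsetP[u uML ->].
have [_ _ nA E3] := inv_match inv (gP u uML).
rewrite in_setD nA; apply: hE E3 _.
by move: uML; rewrite inE => /andP[].
Qed.

(** Pigeonhole: [n] vertices cannot occupy all [n + 1] positive levels. *)
Lemma missing_level n (p : 'I_n -> nat) :
  exists2 j, 0 < j <= n.+1 & forall v, p v <> j.
Proof.
have [/existsP[j /forallP hj]|h] := boolP [exists j : 'I_n.+1, [forall v, p v != j.+1]].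
  by exists j.+1; [rewrite ltnS /= ltn_ord | move=> v; apply/eqP].
have hj (j : 'I_n.+1) : exists v, p v == j.+1.
  by move: h; rewrite negb_exists => /forallP/(_ j); rewrite negb_forall => /existsP[v];
     rewrite negbK; exists v.
pose f j := xchoose (hj j).
have fP j : p (f j) = j.+1 by apply/eqP/(xchooseP (hj j)).
have /leq_card : injective f.
  by move=> i j ij; apply: val_inj; have := fP i; rewrite ij fP => -[].
by rewrite !card_ord ltnn.
Qed.

(* König's theorem: no right vertex outside [near e s] has price [j], and the
   cover takes the right ends of the matching edges priced above [j] and the
   left ends of those priced below. Along an edge the price of a partner
   exceeds that of a neighbour by at most one, so no edge crosses the gap. *)
Lemma cover_of_auction n (e : rel 'I_n) s t ml mr p :
  auction_inv e s t ml mr p -> auction_done e ml p ->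
  exists L R, is_cover e s t L R /\
    #|L| + #|R| <= #|[set u | ml u]| + #|near e s|.
Proof.
move=> inv fin; set A := near e s; set B := near e t; set M := [set u | ml u].
(* Vertices near [s] are moved to level 0, so that their price [n + 1] does not occupy a level. *)
have [j /andP[j0 jn] hj] := missing_level (fun v => if v \in A then 0 else p v).
have nj v : v \notin A -> p v <> j by move=> vA; have := hj v; rewrite (negPf vA).
pose H := [set v | (v \notin A) && (j < p v)].
pose L := B :|: [set u | [exists v, [&& mr v == (nat_of_ord u).+1, v \notin A & p v < j]]].
exists L, (A :|: H); split.
  split; [exact: subsetUl|exact: subsetUl|move=> u v uv uL].
  rewrite !in_setU; case: (boolP (v \in A)) => //= vA; rewrite inE vA /= ltnNge.
  apply/negP => pj; have {}pj : p v < j by have := nj v vA; lia.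
  move: uL; rewrite in_setU negb_or => /andP[uB uL].
  have [uM|uM] := boolP (ml u); last by have := fin u v uM uv; lia.
  case: (inv_left inv uM) => [|[w hw]]; first by rewrite (negPf uB).
  have [_ _ wA _] := inv_match inv hw.
  move/negP: uL; apply; rewrite inE; apply/existsP; exists w.
  rewrite hw eqxx wA /=; have := inv_price inv hw uv; have := nj w wA; lia.
have -> : #|A :|: H| = #|A| + #|H|.
  rewrite cardsU; suff -> : A :&: H = set0 by rewrite cards0 subn0.
  by apply/setP => u; rewrite in_setI in_set0; case: (boolP (u \in A)) => //= uA; rewrite inE uA.
(* A vertex of [H] has positive price and hence an owner. The owners of [H] are marked and lie
   outside [L], as the price of what they own is above [j]. *)
suff : #|L| + #|H| <= #|M| by lia.
have partner v : v \in H -> exists u : 'I_n, mr v == (nat_of_ord u).+1.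
  rewrite inE => /andP[vA jp]; have mv0 : mr v <> 0.
    by move=> m0; have := inv_free inv vA m0; lia.
  have hr : (mr v).-1 < n by have := inv_range inv v; lia.
  by exists (Ordinal hr); rewrite /= prednK //; lia.
pose g v := odflt v [pick u : 'I_n | mr v == (nat_of_ord u).+1].
have gP v : v \in H -> mr v = (nat_of_ord (g v)).+1.
  move=> vH; rewrite /g; case: pickP => [u /eqP //|h].
  by have [u hu] := partner v vH; rewrite h in hu.
rewrite -(@card_in_imset _ _ g H); last first.
  move=> v w vH wH vw; apply: (inv_inj inv); first by rewrite !gP // vw.
  by rewrite gP.
have <- : #|L :|: g @: H| = #|L| + #|g @: H|.
  rewrite cardsU; suff -> : L :&: g @: H = set0 by rewrite cards0 subn0.
  apply/setP => u; rewrite in_setI in_set0; apply/negP => /andP[uL /imsetP[v vH uv]].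
  have mv := gP v vH; have [_ nB _ _] := inv_match inv mv.
  move: uL; rewrite in_setU uv (negPf nB) /= inE => /existsP[w /and3P[/eqP mw wA pw]].
  have vw : v = w by apply: (inv_inj inv); rewrite mv.
  by move: vH; rewrite inE vw => /andP[_]; lia.
apply: subset_leq_card; apply/subsetP => u; rewrite in_setU => /orP[].
  rewrite in_setU => /orP[uB|]; first by rewrite inE (inv_sink inv uB).
  by rewrite !inE => /existsP[w /and3P[/eqP /(inv_match inv)[]]].
by case/imsetP => v vH ->; rewrite inE; have [] := inv_match inv (gP v vH).
Qed.

(** Both duality directions make the count the minimum of [#|L| + #|R|]. Adjacency is tested apart:
    covers exist even when [s] and [t] are adjacent. *)
Theorem auction_decides n (e : rel 'I_n) s t k ml mr p :
  symmetric e -> s != t -> auction_inv e s t ml mr p -> auction_done e ml p ->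
  secluded_st_separator e s t k <->
  ~~ e s t /\ #|[set u | ml u]| + #|near e s| <= k + n.
Proof.
move=> e_sym st inv fin; split=> [sep|[nst hk]].
  split; first exact: separator_nonadjacent sep.
  have [L [R [cov le]]] := cover_of_separator e_sym sep.
  exact: leq_trans (matching_le_cover inv cov) le.
have [L [R [cov le]]] := cover_of_auction inv fin.
exact: separator_of_cover e_sym st nst cov (leq_trans le hk).
Qed.

(** One bid of [u] for [v]. Bidding for a cheapest neighbour gives [inv_price] for [u]; for other
    owners it persists because their own price is unchanged and no price falls. *)
Lemma auction_inv_update n (e : rel 'I_n) s t ml mr p ml' mr' p' u v :
  auction_inv e s t ml mr p -> ~~ ml u -> ball3 e u v -> p v <= n ->
  (forall w, ball3 e u w -> p v <= p w) ->
  (forall x, ml' x = (x == u) || ml x && (mr v != (nat_of_ord x).+1)) ->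
  (forall x, mr' x = if x == v then (nat_of_ord u).+1 else mr x) ->
  (forall x, p' x = if x == v then (p v).+1 else p x) ->
  auction_inv e s t ml' mr' p'.
Proof.
move=> inv uM uv pv pmin eml emr ep.
have uB : u \notin near e t by apply: contra uM => /(inv_sink inv).
have vA : v \notin near e s by apply/negP => /(inv_source inv) h; rewrite h ltnn in pv.
have free w : mr w <> (nat_of_ord u).+1.
  by move=> /(inv_match inv)[h]; rewrite h in uM.
have ple x : p x <= p' x by rewrite ep; case: eqVneq => [->|//].
split.
- move=> x w; rewrite emr eml; case: eqVneq => [-> [/val_inj <-]|wv hw].
    by rewrite eqxx.
  have [xM xB wA xw] := inv_match inv hw; split=> //; rewrite xM.
  apply/orP; right; apply/eqP => hv.
  by move/eqP: wv; apply; apply: (inv_inj inv); rewrite hw.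
- move=> x w y; rewrite emr ep; case: eqVneq => [_ [/val_inj <-]|_ hw] h.
    by rewrite ltnS; apply: leq_trans (pmin _ h) (ple y).
  by apply: leq_trans (inv_price inv hw h) _; rewrite ltnS.
- move=> x y; rewrite !emr; case: (eqVneq x v); case: (eqVneq y v) => //.
  + by move=> -> ->.
  + by move=> _ _ /esym/free.
  + by move=> _ _ /free.
  + by move=> _ _; exact: inv_inj inv x y.
- move=> x; rewrite eml => /orP[/eqP->|/andP[xM hx]].
    by right; exists v; rewrite emr eqxx.
  case: (inv_left inv xM) => [|[w hw]]; [by left|right; exists w].
  by rewrite emr ifN //; apply: contra hx => /eqP <-; rewrite hw.
- move=> x xB; rewrite eml (inv_sink inv xB) /=; apply/orP; right.
  by apply/eqP => /(inv_match inv)[_]; rewrite xB.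
- move=> x xA; rewrite ep; case: eqVneq => [xv|_]; last exact: inv_source inv x xA.
  by rewrite -xv xA in vA.
- by move=> x; rewrite ep; case: ifP => // _; exact: inv_bound inv x.
- by move=> x xA; rewrite emr ep; case: ifP => // _; exact: inv_free inv x xA.
- by move=> x; rewrite emr; case: ifP => // _; exact: inv_range inv x.
Qed.

(** * The decision procedure *)

Definition frame (ws ids : seq nat) (s s' : state) : Prop :=
  (forall r, r \notin ws -> vars s' r = vars s r) /\
  (forall id, id \notin ids -> arrs s' id = arrs s id).

(** Loop rule whose frame is read off the syntax, so an invariant need only mention what the body
    changes. *)
Lemma exec_for c i s (I : nat -> state -> Prop) :
  i != 1 -> 1 \notin wvars c -> I 0 s ->
  (forall k s', k < vars s 1 -> frame (i :: wvars c) (warrs c) s s' -> I k s' ->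
     I k.+1 (exec c (set_var s' i k))) ->
  exists s', [/\ exec (CFor i c) s = set_var s' i (vars s 1),
    frame (i :: wvars c) (warrs c) s s' & I (vars s 1) s'].
Proof.
move=> i1 n1 I0 IS; set N := vars s 1.
pose S k := iteri k (fun k s' => exec c (set_var s' i k)) s.
suff [F H] : frame (i :: wvars c) (warrs c) s (S N) /\ I N (S N) by exists (S N).
suff key k : k <= N -> frame (i :: wvars c) (warrs c) s (S k) /\ I k (S k) by exact: key.
elim: k => [|k IH] hk; first by split.
have [fr Ik] := IH (ltnW hk); split; last exact: IS.
have [f1 f2] := fr; split=> [r|id].
  rewrite inE negb_or => /andP[/negPf ri rc].
  by rewrite /= exec_vars //= /upd ri f1 // inE ri.
by move=> h; rewrite /= exec_arrs // f2.
Qed.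

Lemma exec_seq c1 c2 s : exec (CSeq c1 c2) s = exec c2 (exec c1 s).
Proof. by []. Qed.

Notation "c1 ;; c2" := (CSeq c1 c2) (at level 60, right associativity).

(** The row-major index goes to variable 8; lacking multiplication, it adds [a] once per round. *)
Definition index_cmd a b := CConst 8 0 ;; CFor 12 (CAdd 8 8 a) ;; CAdd 8 8 b.
Definition load2 r id a b := index_cmd a b ;; CLoad r id 8.

Lemma index_cmdP a b s : a \notin [:: 8; 12] -> b \notin [:: 8; 12] ->
  let s1 := exec (index_cmd a b) s in
  [/\ vars s1 8 = vars s a * vars s 1 + vars s b,
      forall r, r \notin [:: 8; 12] -> vars s1 r = vars s r
    & arrs s1 = arrs s].
Proof.
rewrite !inE !negb_or => /andP[/negPf a8 /negPf a12] /andP[/negPf b8 /negPf b12] s1.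
have e1 : forall r, r \notin [:: 8; 12] -> vars s1 r = vars s r.
  by move=> r hr; apply: exec_vars; move: hr; rewrite /= !inE; case: eqP => //= _ /negPf->.
have e2 : arrs s1 = arrs s.
  rewrite /s1 /index_cmd !exec_seq /=.
  by elim: (upd _ _ _ 1) => //= k <-.
split=> //; rewrite /s1 /index_cmd !exec_seq.
have [|||k s' hk [fr _]|s' [-> _ hs]] := @exec_for (CAdd 8 8 a) 12 (exec (CConst 8 0) s)
  (fun k s' => vars s' 8 = k * vars s a /\ vars s' b = vars s b) => //.
- by rewrite /= /upd b8.
- move=> [h1 h2]; rewrite /= /upd /= b8 b12 a12 h1 h2; split=> //.
  by rewrite (fr a) /= /upd ?a8 ?inE ?a8 ?a12 //; lia.
- by case: hs => h1 h2; rewrite /= /upd /= b12 h1 h2 mulnC.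
Qed.
Arguments index_cmd : simpl never.

Lemma load2P r id a b s : a \notin [:: 8; 12] -> b \notin [:: 8; 12] ->
  let s1 := exec (load2 r id a b) s in
  [/\ vars s1 r = arrs s id (vars s a * vars s 1 + vars s b),
      forall x, x \notin [:: r; 8; 12] -> vars s1 x = vars s x
    & arrs s1 = arrs s].
Proof.
move=> ha hb; have [v f e] := index_cmdP s ha hb; rewrite /load2 exec_seq.
move: (exec (index_cmd a b) s) v f e => s1 v f e /=.
split; [by rewrite /upd eqxx e v| move=> x hx; rewrite /upd | exact: e].
move: hx; rewrite inE negb_or => /andP[/negPf -> hx]; exact: f.
Qed.
Arguments load2 : simpl never.

Lemma index_inj n i j i' j' : j < n -> j' < n ->
  (i * n + j == i' * n + j') = (i == i') && (j == j').
Proof.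
move=> hj hj'; apply/eqP/andP => [h|[/eqP-> /eqP->] //].
have : (i * n + j) %/ n = (i' * n + j') %/ n by rewrite h.
rewrite !divnMDl ?divn_small ?addn0; lia.
Qed.

(** * Boolean matrices of the balls *)

Definition rep n (s : state) id (M : rel 'I_n) : Prop :=
  forall i j : 'I_n, arrs s id (i * n + j) = M i j.

(* Variables: 1 - 4 are n, s, t, k; 5 - 7 loop indices; 18, 20, 21 hold 1, 0, n + 1; 13
   and 14 the lowest price seen and its vertex; 19 counts; 0 receives the answer.
   Arrays: 0, 1, 2 are the matrices of [ball1], [ball2], [ball3]; 3 marks the vertices
   that are matched on the left or near [t]; 4 is the owner plus one of a right vertex;
   5 its price. *)
Definition diag_cmd := CFor 5 (index_cmd 5 5 ;; CConst 10 1 ;; CStore 0 8 10).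

(** Nothing is known about the diagonal after relocation; filling it with ones yields the reflexive
    closure. *)
Lemma diag_cmdP n (e : rel 'I_n) s : vars s 1 = n ->
  (forall i j : 'I_n, i != j -> arrs s 0 (i * n + j) = e i j) -> irreflexive e ->
  rep (exec diag_cmd s) 0 (ball1 e).
Proof.
move=> s1 hs e_irr.
have [||||s' [es' _ inv]] := @exec_for (index_cmd 5 5 ;; CConst 10 1 ;; CStore 0 8 10) 5 s
  (fun k s' => forall i j : 'I_n,
     arrs s' 0 (i * n + j) = if (i == j) && (i < k) then 1 else arrs s 0 (i * n + j)) => //.
- by move=> i j; rewrite andbF.
- move=> k s'; rewrite s1 => hk [fv _] h i j.
  have [] := @index_cmdP 5 5 (set_var s' 5 k) isT isT; rewrite 2!exec_seq.
  move: (exec _ _) => s2 v _ a; rewrite /= /upd /= v a /= /upd /= fv // s1.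
  rewrite index_inj // h -val_eqE /= ltnS.
  have -> : ((i : nat) == j) && (i <= k) =
      (i == k :> nat) && (j == k :> nat) || ((i : nat) == j) && (i < k) by lia.
  by case: (_ && (_ == k)).
rewrite /diag_cmd es' => i j; rewrite /= inv s1 ltn_ord andbT /ball1 /=.
case: eqVneq => //= ij; exact: hs.
Qed.

Definition prod_inner X Y :=
  load2 9 X 5 7 ;; load2 10 Y 7 6 ;; CIf 9 (CIf 10 (CConst 11 1) CSkip) CSkip.
Definition prod_cell X Y Z :=
  CConst 11 0 ;; CFor 7 (prod_inner X Y) ;; index_cmd 5 6 ;; CStore Z 8 11.
Definition prod_cmd X Y Z := CFor 5 (CFor 6 (prod_cell X Y Z)).

Lemma prod_cellP n (M M' : rel 'I_n) X Y Z s (i j : 'I_n) :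
  vars s 1 = n -> vars s 5 = i -> vars s 6 = j -> rep s X M -> rep s Y M' ->
  arrs (exec (prod_cell X Y Z) s) Z =1
  upd (arrs s Z) (i * n + j) [exists l, M i l && M' l j].
Proof.
move=> s1 s5 s6 hX hY; rewrite /prod_cell 3!exec_seq.
have [|||k s'|s' [-> [fv fa] inv]] := @exec_for (prod_inner X Y) 7 (exec (CConst 11 0) s)
  (fun k s' => vars s' 11 = [exists l : 'I_n, [&& l < k, M i l & M' l j]]) => //.
- rewrite /= /upd /=; suff -> : [exists l : 'I_n, [&& l < 0, M i l & M' l j]] = false by [].
  by apply/existsP => -[].
- move=> hk [fv fa] h; have {}hk : k < n by rewrite -s1; exact: hk.
  pose l := Ordinal hk.
  rewrite /prod_inner 2!exec_seq.
  have [] := @load2P 9 X 5 7 (set_var s' 7 k) isT isT.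
  move: (exec _ _) => s2 v2 f2 a2; have := @load2P 10 Y 7 6 s2 isT isT.
  case; move: (exec _ s2) => s3 v3 f3 a3.
  have e9 : vars s3 9 = M i l.
    rewrite f3 // v2 /= /upd /= !fv //= /upd /= s1 s5 -hX fa //.
  have e10 : vars s3 10 = M' l j.
    by rewrite v3 a2 !f2 //= /upd /= !fv //= /upd /= s1 s6 -hY fa.
  have e11 : vars s3 11 = [exists l : 'I_n, [&& l < k, M i l & M' l j]].
    by rewrite f3 // f2 //= /upd /= h.
  rewrite /= e9 e10.
  have split_l : [exists l0 : 'I_n, [&& l0 < k.+1, M i l0 & M' l0 j]] =
      (M i l && M' l j) || [exists l : 'I_n, [&& l < k, M i l & M' l j]].
    apply/existsP/orP => [[x /and3P[]]|[h1|/existsP[x /and3P[h1 h2 h3]]]].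
    - rewrite ltnS leq_eqVlt => /orP[/eqP xk|xk] h1 h2; [left|right].
        by have -> : l = x by [apply: val_inj]; rewrite h1.
      by apply/existsP; exists x; rewrite xk h1.
    - by exists l; rewrite /= leqnn.
    - by exists x; rewrite leqW // h2.
  rewrite split_l; case: (M i l); case: (M' l j) => //=; rewrite ?e11 //.
have [] := @index_cmdP 5 6 (set_var s' 7 (vars (exec (CConst 11 0) s) 1)) isT isT.
move: (exec _ _) => s2 v2 f2 a2 x; rewrite /= eqxx v2 f2 // a2 /= /upd /= inv.
rewrite !fv //= /upd /= s5 s6 s1 fa //=; case: ifP => // _; congr (nat_of_bool _).
by apply: eq_existsb => l; rewrite ltn_ord.
Qed.

(** Boolean matrix product. The target must differ from both factors, which are still read while it
    is written. *)
Lemma prod_cmdP n (M M' : rel 'I_n) X Y Z s : X != Z -> Y != Z ->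
  vars s 1 = n -> rep s X M -> rep s Y M' ->
  rep (exec (prod_cmd X Y Z) s) Z [rel i j | [exists l, M i l && M' l j]].
Proof.
move=> XZ YZ s1 hX hY; set MM := [rel i j | _].
have [||||s' [es' _ inv]] := @exec_for (CFor 6 (prod_cell X Y Z)) 5 s
  (fun k s' => forall i j : 'I_n, i < k -> arrs s' Z (i * n + j) = MM i j) => //.
- rewrite s1 => k s0 hk [fv0 fa0] h0; pose i := Ordinal hk.
  (* The cells correct so far are all earlier rows and the first [k'] cells of row [k]. *)
  have [||||s' [es' [fv fa] inv]] := @exec_for (prod_cell X Y Z) 6 (set_var s0 5 k)
    (fun k' s' => forall i' j' : 'I_n, (i' < k) || (i' == i) && (j' < k') ->
       arrs s' Z (i' * n + j') = MM i' j') => //.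
  + by move=> i' j'; rewrite andbF orbF /=; apply: h0.
  + have s01 : vars (set_var s0 5 k) 1 = n by rewrite /= /upd /= fv0.
    rewrite s01 => k' s2 hk' [fv fa] h; pose j := Ordinal hk'.
    move=> i' j' hij; rewrite (@prod_cellP n M M' X Y Z _ i j).
    * rewrite /upd index_inj // [i' == k :> nat](_ : _ = (i' == i)) //.
      rewrite [j' == k' :> nat](_ : _ = (j' == j)) //.
      case: (eqVneq i' i) hij => [->|i'i] /=; last first.
        by rewrite orbF => h1; apply: h; rewrite h1.
      case: (eqVneq j' j) => [->|j'j] h1; first by rewrite /MM /=.
      apply: (h i j'); rewrite eqxx /=.
      by move: h1 j'j; rewrite -val_eqE /=; lia.
    * by rewrite /= /upd /= fv.
    * by rewrite /= /upd /= fv.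
    * by rewrite /= /upd /=.
    * by move=> u v; rewrite /= fa /= ?inE ?(negPf XZ) // fa0 //= inE.
    * by move=> u v; rewrite /= fa /= ?inE ?(negPf YZ) // fa0 //= inE.
  move=> i' j'; rewrite ltnS leq_eqVlt => hi; rewrite es' /=; apply: inv.
  have -> : vars (set_var s0 5 k) 1 = n by rewrite /= /upd /= fv0.
  by rewrite ltn_ord andbT orbC.
by rewrite /prod_cmd es' => i j; rewrite /= inv // s1.
Qed.

(** The price [n + 1] takes right vertices near [s] out of reach, and the mark keeps left vertices
    near [t] from bidding, so no copy has to be deleted. *)
Definition init_body :=
  load2 9 1 2 6 ;; CIf 9 (CStore 5 6 21 ;; CAdd 19 19 18) (CStore 5 6 20) ;;
  CStore 4 6 20 ;; load2 9 1 3 6 ;; CStore 3 6 9.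
Definition init_cmd :=
  CConst 18 1 ;; CConst 20 0 ;; CAdd 21 1 18 ;; CConst 19 0 ;; CFor 6 init_body.

Lemma init_cmdP n (e : rel 'I_n) (s t : 'I_n) st :
  vars st 1 = n -> vars st 2 = s -> vars st 3 = t -> rep st 1 (ball2 e) ->
  let st' := exec init_cmd st in
  [/\ vars st' 18 = 1, vars st' 20 = 0, vars st' 21 = n.+1,
      vars st' 19 = #|near e s|
    & forall v : 'I_n, [/\ arrs st' 3 v = (v \in near e t), arrs st' 4 v = 0
        & arrs st' 5 v = if v \in near e s then n.+1 else 0]].
Proof.
move=> h1 h2 h3 hD; rewrite /init_cmd 4!exec_seq.
set st0 := exec (CConst 19 0) _.
have [b1 b2 b3 bD] : [/\ vars st0 1 = n, vars st0 2 = s, vars st0 3 = t & rep st0 1 (ball2 e)].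
  by rewrite /= /upd /=.
have [c18 c20 c21 c19] :
    [/\ vars st0 18 = 1, vars st0 20 = 0, vars st0 21 = n.+1 & vars st0 19 = 0].
  by rewrite /= /upd /= h1 addn1.
move: st0 b1 b2 b3 bD c18 c20 c21 c19 => {h1 h2 h3 hD}st b1 b2 b3 bD c18 c20 c21 c19.
have [||||s' [-> [fv fa] [inv c]]] := @exec_for init_body 6 st
  (fun k s' => (forall v : 'I_n, v < k -> [/\ arrs s' 3 v = (v \in near e t), arrs s' 4 v = 0
        & arrs s' 5 v = if v \in near e s then n.+1 else 0]) /\
    vars s' 19 = \sum_(0 <= x < k) arrs st 1 (s * n + x)) => //.
- by rewrite big_geq.
- rewrite b1 => k s1 hk [fv fa] [inv c]; pose v := Ordinal hk.
  rewrite /init_body 2!exec_seq.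
  have [] := @load2P 9 1 2 6 (set_var s1 6 k) isT isT.
  move: (exec _ (set_var s1 6 k)) => s2 v2 f2 a2.
  have e9 : vars s2 9 = (v \in near e s).
    by rewrite v2 /= /upd /= !fv // b1 b2 fa // inE -bD.
  set s3 := exec (CIf _ _ _) s2.
  have [g19 [g1 g3] [g4 g5] g] : [/\ vars s3 19 = vars s1 19 + (v \in near e s),
     arrs s3 1 = arrs s1 1 /\ arrs s3 3 = arrs s1 3,
     arrs s3 4 = arrs s1 4 /\ arrs s3 5 =1 upd (arrs s1 5) k (if v \in near e s then n.+1 else 0)
     & forall r, r \in [:: 1; 2; 3; 6; 18; 20; 21] -> vars s3 r = vars (set_var s1 6 k) r].
    rewrite /s3 /= e9; case: (v \in near e s) => /=; split=> //.
    + by rewrite /upd /= !f2 //= /upd /= (fv 18) // c18.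
    + by rewrite a2.
    + by rewrite a2 !f2 //= /upd /= fv // c21.
    + by move=> r hr; rewrite /= /upd; move: hr; rewrite !inE => hr; rewrite ifN ?f2 ?inE //; lia.
    + by rewrite f2 //= /upd /= addn0.
    + by rewrite a2.
    + by rewrite a2 !f2 //= /upd /= fv // c20.
    + by move=> r hr; rewrite f2 //; move: hr; rewrite !inE; lia.
  rewrite 2!exec_seq; set s4 := exec (CStore 4 6 20) s3.
  have [] := @load2P 9 1 3 6 s4 isT isT.
  move: (exec _ s4) => s5 v5 f5 a5.
  have e9' : vars s5 9 = (v \in near e t).
    rewrite v5 /s4 /= !g //= /upd /= !fv // b1 b3 g1 fa //.
    by rewrite inE -bD.
  have e6 : vars s5 6 = k by rewrite f5 // /s4 /= g.
  split; last first.
    by rewrite /= f5 // /s4 /= g19 c big_nat_recr //= -[s * n + k]/(s * n + v) bD inE.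
  move=> w; rewrite ltnS leq_eqVlt /= /upd e6 e9' a5 /s4 /= /upd !g //= /upd /= g3 g4 fv // c20.
  rewrite g5 /upd; case: eqP => [wk|wk] /=.
    by rewrite (_ : w = v) //; apply: val_inj.
  by move/inv.
split=> //; last by move=> v; apply: inv; rewrite b1.
- by rewrite /= /upd /= fv.
- by rewrite /= /upd /= fv.
- by rewrite /= /upd /= fv.
- rewrite /= /upd /= c b1 big_mkord -sum1_card [RHS]big_mkcond; apply: eq_bigr => v _.
  by rewrite bD inE; case: ifP.
Qed.

(** * One bid of the auction *)

Definition scan_body :=
  load2 9 2 5 6 ;;
  CIf 9 (CLoad 10 5 6 ;; CSub 11 13 10 ;;
         CIf 11 (CAdd 13 10 20 ;; CAdd 14 6 20) CSkip) CSkip.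

(** Starting the minimum at [n + 1] hides every unaffordable neighbour, so a final value of at most
    [n] comes with a vertex attaining it. *)
Lemma scanP n (e : rel 'I_n) (u : 'I_n) s :
  vars s 1 = n -> vars s 5 = u -> vars s 13 = n.+1 -> vars s 20 = 0 ->
  rep s 2 (ball3 e) ->
  let s' := exec (CFor 6 scan_body) s in
  [/\ vars s' 13 <= n.+1, forall w : 'I_n, ball3 e u w -> vars s' 13 <= arrs s 5 w
    & vars s' 13 <= n -> exists v : 'I_n,
        [/\ vars s' 14 = v, ball3 e u v & arrs s 5 v = vars s' 13]].
Proof.
move=> s1 s5 s13 s20 hE.
have [||||s' [-> _ [i1 i2 i3]]] := @exec_for scan_body 6 s
  (fun k s' => [/\ vars s' 13 <= n.+1,
     forall w : 'I_n, w < k -> ball3 e u w -> vars s' 13 <= arrs s 5 w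
    & vars s' 13 <= n -> exists v : 'I_n,
        [/\ vars s' 14 = v, ball3 e u v & arrs s 5 v = vars s' 13]]) => //.
- by rewrite s13 ltnn; split.
- rewrite s1 => k s' hk [fv fa] [i1 i2 i3]; pose v := Ordinal hk.
  rewrite /scan_body exec_seq.
  have [] := @load2P 9 2 5 6 (set_var s' 6 k) isT isT.
  move: (exec _ (set_var s' 6 k)) => s2 v2 f2 a2.
  have e9 : vars s2 9 = ball3 e u v.
    by rewrite v2 /= /upd /= !fv // s1 s5 fa // -hE.
  have e13 : vars s2 13 = vars s' 13 by rewrite f2.
  have e14 : vars s2 14 = vars s' 14 by rewrite f2.
  have e6 : vars s2 6 = k by rewrite f2.
  have e20 : vars s2 20 = 0 by rewrite f2 //= /upd /= fv.
  have e5 : arrs s2 5 k = arrs s 5 v by rewrite a2 /= fa.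
  have stay x y : x = vars s' 13 -> y = vars s' 14 ->
      (ball3 e u v -> vars s' 13 <= arrs s 5 v) -> 
      [/\ x <= n.+1, forall w : 'I_n, w < k.+1 -> ball3 e u w -> x <= arrs s 5 w
       & x <= n -> exists v : 'I_n, [/\ y = v, ball3 e u v & arrs s 5 v = x]].
    move=> -> -> h; split=> // w; rewrite ltnS leq_eqVlt => /orP[/eqP wk|]; last exact: i2.
    by have -> : w = v by apply: val_inj.
  rewrite [exec _ _]/= e9; case: (boolP (ball3 e u v)) => uv; last first.
    by rewrite e13 e14; apply: stay => // h; rewrite h in uv.
  rewrite [_ == 0]/= /= /upd /= e13 e6 e5; case: ifP => [h|h].
    by rewrite /= /upd /= e13 e14; apply: stay => // _; rewrite -subn_eq0.
  have {}h : arrs s 5 v < vars s' 13 by rewrite ltnNge -subn_eq0 h.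
  rewrite /= /upd /= ?e6 ?e20 ?addn0 ?e5; split.
  + by apply: leq_trans i1; apply: ltnW.
  + move=> w; rewrite ltnS leq_eqVlt => /orP[/eqP wk|wk hw].
      by have -> : w = v by apply: val_inj.
    by apply: leq_trans (i2 w wk hw); apply: ltnW.
  + by move=> _; exists v.
rewrite /= /upd /=; split=> //; first by move=> w; apply: i2; rewrite s1.
Qed.

Definition update_cmd :=
  CLoad 9 4 14 ;; CIf 9 (CSub 9 9 18 ;; CStore 3 9 20) CSkip ;; CAdd 9 5 18 ;;
  CStore 4 14 9 ;; CStore 3 5 18 ;; CAdd 13 13 18 ;; CStore 5 14 13.
Definition visit_cmd :=
  CLoad 9 3 5 ;;
  CIf 9 CSkip (CAdd 13 21 20 ;; CFor 6 scan_body ;; CSub 11 21 13 ;; CIf 11 update_cmd CSkip).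

Definition state_left n (st : state) (u : 'I_n) : bool := arrs st 3 u != 0.
Definition state_right n (st : state) (v : 'I_n) : nat := arrs st 4 v.
Definition state_price n (st : state) (v : 'I_n) : nat := arrs st 5 v.

Definition state_inv n (e : rel 'I_n) (s t : 'I_n) (st : state) : Prop :=
  [/\ vars st 1 = n, vars st 18 = 1, vars st 20 = 0 & vars st 21 = n.+1] /\
  rep st 2 (ball3 e) /\
  auction_inv e s t (state_left st) (@state_right n st) (@state_price n st).

Definition inactive n (e : rel 'I_n) (st : state) (u : 'I_n) : bool :=
  state_left st u || [forall w, ball3 e u w ==> (n < state_price st w)].

(** The progress measure: a bid raises it by one, and it never exceeds [n * n.+1]. *)
Definition total_price n (st : state) : nat := \sum_(v < n) state_price st v.

Lemma state_inv_set_var n (e : rel 'I_n) s t st i x :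
  i \notin [:: 1; 18; 20; 21] -> state_inv e s t st -> state_inv e s t (set_var st i x).
Proof.
rewrite !inE !negb_or => /and4P[/negPf i1 /negPf i2 /negPf i3 /negPf i4] [[h1 h2 h3 h4] h].
by split; rewrite // /= /upd !(eq_sym _ i) i1 i2 i3 i4.
Qed.

(** If [v] is free then [r] is 0 and [x.+1 == r] never holds, so nobody is evicted. *)
Lemma update_cmdP (s : state) (u v : nat) (r := arrs s 4 v) :
  vars s 14 = v -> vars s 5 = u -> vars s 18 = 1 -> vars s 20 = 0 ->
  let s' := exec update_cmd s in
  [/\ arrs s' 3 =1 fun x => if x == u then 1 else if x.+1 == r then 0 else arrs s 3 x,
      arrs s' 4 =1 upd (arrs s 4) v u.+1
    & arrs s' 5 =1 upd (arrs s 5) v (vars s 13).+1].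
Proof.
rewrite {}/r => s14 s5 s18 s20; rewrite /update_cmd 2!exec_seq.
set s2 := exec (CIf _ _ _) _.
have [g3 [g4 g5] gv] : [/\ arrs s2 3 =1 fun x => if x.+1 == arrs s 4 v then 0 else arrs s 3 x,
   arrs s2 4 = arrs s 4 /\ arrs s2 5 = arrs s 5
   & forall x, x != 9 -> vars s2 x = vars s x].
  rewrite /s2 /= /upd /= s14; case: eqP => [r0|r0]; split=> //.
  - by rewrite r0.
  - by move=> x /negPf h; rewrite /= /upd h.
  - move=> x; rewrite /= /upd /= s18 s20.
    by have -> : (x == arrs s 4 v - 1) = (x.+1 == arrs s 4 v) by lia.
  - by move=> x /negPf h; rewrite /= /upd h.
rewrite /= /upd /= !gv // s14 s5 s18 addn1 addn1 g4 g5; split=> // x.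
by rewrite g3.
Qed.

Lemma visit_cmdP n (e : rel 'I_n) s t st (u : 'I_n) :
  state_inv e s t st -> vars st 5 = u ->
  let st' := exec visit_cmd st in
  state_inv e s t st' /\
  ((inactive e st u /\ forall id, arrs st' id = arrs st id) \/
   (~~ inactive e st u /\ total_price n st' = (total_price n st).+1)).
Proof.
move=> inv s5; set st' := exec _ _; rewrite /=.
have [[s1 s18 s20 s21] [hE ainv]] := inv.
have frm : [/\ vars st' 1 = n, vars st' 18 = 1, vars st' 20 = 0 & vars st' 21 = n.+1].
  by rewrite /st' !exec_vars.
have frE : rep st' 2 (ball3 e) by rewrite /rep /st' exec_arrs.
suff H : auction_inv e s t (state_left st') (@state_right n st') (@state_price n st') /\
  ((inactive e st u /\ forall id, arrs st' id = arrs st id) \/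
   (~~ inactive e st u /\ total_price n st' = (total_price n st).+1)).
  by case: H => H1 H2; split.
have same : (forall id, arrs st' id = arrs st id) -> inactive e st u ->
  auction_inv e s t (state_left st') (@state_right n st') (@state_price n st') /\
  ((inactive e st u /\ forall id, arrs st' id = arrs st id) \/
   (~~ inactive e st u /\ total_price n st' = (total_price n st).+1)).
  move=> h hi; split; last by left.
  by rewrite /state_left /state_right /state_price !h.
have [uM|uM] := boolP (state_left st u).
  apply: same; last by rewrite /inactive uM.
  move=> id; rewrite /st' /visit_cmd exec_seq.
  rewrite -[exec (CIf _ _ _) _]/(if _ then _ else _) [X in X == 0]/= /upd [X in X == 0]/= s5.
  by move: uM; rewrite /state_left => /negPf ->.
have est' : st' = exec (CFor 6 scan_body ;; CSub 11 21 13 ;; CIf 11 update_cmd CSkip)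
    (set_var (exec (CLoad 9 3 5) st) 13 (vars st 21 + vars st 20)).
  rewrite /st' /visit_cmd exec_seq; move: uM; rewrite /state_left negbK => /eqP uM.
  rewrite -[exec (CIf _ _ _) _]/(if _ then _ else _) [X in X == 0]/= /upd.
  by rewrite [X in X == 0]/= s5 uM.
set sa := set_var _ 13 _ in est'.
have [a1 a5 a13 a20] : [/\ vars sa 1 = n, vars sa 5 = u, vars sa 13 = n.+1 & vars sa 20 = 0].
  by rewrite /sa /= /upd /= s1 s5 s20 s21 addn0.
have aE : rep sa 2 (ball3 e) by [].
have [i1 i2 i3] := scanP a1 a5 a13 a20 aE.
move: est'; rewrite 2!exec_seq.
set sb := exec (CFor 6 scan_body) sa in i1 i2 i3 *.
have [b5 b18 b20 b21] : [/\ vars sb 5 = u, vars sb 18 = 1, vars sb 20 = 0 & vars sb 21 = n.+1].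
  by rewrite /sb !exec_vars //= /upd.
have barr id : arrs sb id = arrs st id by rewrite /sb exec_arrs.
clearbody sb; rewrite -[exec (CIf _ _ _) _]/(if _ then _ else _) [X in X == 0]/= /upd /= b21.
case: eqP => [h|h] est'.
  apply: same; first by move=> id; rewrite est' /= barr.
  rewrite /inactive (negPf uM) /=; apply/forallP => w; apply/implyP => uw.
  have le : vars sb 13 <= state_price st w := i2 w uw.
  by lia.
(* A nonzero truncated difference from [n + 1] means that the minimum is at most [n]. *)
have [v [b14 uv pv]] := i3 ltac:(lia).
have [||||g3 g4 g5] := @update_cmdP (set_var sb 11 (vars sb 21 - vars sb 13)) u v => //.
have {}est' : st' = exec update_cmd (set_var sb 11 (vars sb 21 - vars sb 13)).
  by rewrite est' b21.
rewrite -est' /= in g3 g4 g5; rewrite !barr in g3 g4 g5; rewrite /upd /= in g4 g5.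
have pvn : state_price st v <= n by rewrite /state_price pv; lia.
split; last right; last split.
- apply: (auction_inv_update ainv uM uv pvn).
  + by move=> w uw; rewrite /state_price pv; apply: i2.
  + move=> x; rewrite /state_left g3 -val_eqE /= /state_right eq_sym [_ == x.+1]eq_sym.
    by rewrite eq_sym; case: ifP => //= _; case: ifP => //= _; rewrite ?andbF ?andbT.
  + by move=> x; rewrite /state_right g4.
  + by move=> x; rewrite /state_price g5 pv.
- rewrite /inactive (negPf uM) /= negb_forall; apply/existsP; exists v.
  by rewrite uv /= -leqNgt.
- rewrite /total_price (bigD1 v) //= [in RHS](bigD1 v) //= -addSn; congr (_ + _).
    by rewrite /state_price g5 eqxx pv.
  by apply: eq_bigr => x xv; rewrite /state_price g5 ifN.
Qed.

(** * Running the auction to its end *)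

Definition pass_cmd := CFor 5 visit_cmd.
(** Three nested loops give [n ^ 3] passes, more than the price bound [n * n.+1] once [n] is at
    least 2. *)
Definition rounds_cmd := CFor 15 (CFor 16 (CFor 17 pass_cmd)).

(** Without a bid the arrays never change during the pass, so all visits judge the same state and
    the auction is over. *)
Lemma pass_cmdP n (e : rel 'I_n) s t st : state_inv e s t st ->
  let st' := exec pass_cmd st in
  state_inv e s t st' /\
  (total_price n st < total_price n st' /\ (exists u, ~~ inactive e st u) \/
   (forall id, arrs st' id = arrs st id) /\ forall u, inactive e st u).
Proof.
move=> inv; have s1 : vars st 1 = n by case: inv => -[].
have [||||s' [-> _ [inv' H]]] := @exec_for visit_cmd 5 st
  (fun k s' => state_inv e s t s' /\
    (total_price n st < total_price n s' /\ (exists u, ~~ inactive e st u) \/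
     (forall id, arrs s' id = arrs st id) /\
     forall u : 'I_n, u < k -> inactive e st u)) => //.
- by split=> //; right.
- rewrite s1 => k s' hk _ [inv' H]; pose u := Ordinal hk.
  have inv5 : state_inv e s t (set_var s' 5 k) by apply: state_inv_set_var.
  have [inv2 V] := @visit_cmdP n e s t (set_var s' 5 k) u inv5 erefl.
  split=> //; case: V => [[hi same]|[hi grow]].
    have eqT : total_price n (exec visit_cmd (set_var s' 5 k)) = total_price n s'.
      by rewrite /total_price /state_price same.
    case: H => [h|[h1 h2]]; [by left; rewrite eqT|right; split=> [id|w]].
      by rewrite same /= h1.
    rewrite ltnS leq_eqVlt => /orP[/eqP wk|]; last exact: h2.
    have -> : w = u by apply: val_inj.
    by move: hi; rewrite /inactive /state_left /state_price /= !h1.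
  left; rewrite grow; case: H => [[h hu]|[h1 h2]]; first by split=> //; apply: leqW.
  split; first by rewrite /total_price /state_price h1.
  by exists u; move: hi; rewrite /inactive /state_left /state_price /= !h1.
split; first exact: state_inv_set_var.
by case: H => [h|[h1 h2]]; [left|right; split=> // u; apply: h2; rewrite s1].
Qed.

(** Each round advances the progress bound by [d]; nesting multiplies the gains. *)
Lemma exec_repeat c i n d (K : nat -> state -> Prop) q st :
  i != 1 -> 1 \notin wvars c -> (forall q s x, K q s -> K q (set_var s i x)) ->
  (forall q s, vars s 1 = n -> K q s -> K (q + d) (exec c s)) ->
  vars st 1 = n -> K q st -> K (q + n * d) (exec (CFor i c) st).
Proof.
move=> i1 n1 Kset Kstep s1 Kq.
have [||||s' [-> _]] := @exec_for c i st (fun k s' => K (q + k * d) s') => //.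
- by rewrite addn0.
- move=> k s' _ [fv _] h; rewrite mulSn addnCA addnC; apply: Kstep; last exact: Kset.
  by rewrite /= /upd eq_sym (negPf i1) fv ?s1 // inE eq_sym negb_or i1.
by rewrite s1; exact: Kset.
Qed.

Lemma rounds_cmdP n (e : rel 'I_n) s t st : 1 < n -> state_inv e s t st ->
  let st' := exec rounds_cmd st in
  state_inv e s t st' /\ forall u, inactive e st' u.
Proof.
move=> n2 inv st'.
pose K q s' := state_inv e s t s' /\
  (q <= total_price n s' \/ forall u, inactive e s' u).
have Kset i : i \notin [:: 1; 18; 20; 21] -> forall q s' x, K q s' -> K q (set_var s' i x).
  by move=> hi q s' x [h1 h2]; split=> //; exact: state_inv_set_var.
have s1 : vars st 1 = n by case: inv => -[].
have [inv' H] : K (0 + n * (n * (n * 1))) st'.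
  apply: (@exec_repeat _ _ n _ K) => //; last by split=> //; left.
  move=> q1 s2 s21 k1; apply: (@exec_repeat _ _ n _ K) => //.
  move=> q2 s3 s31 k2; apply: (@exec_repeat _ _ n _ K) => //.
  move=> q s' s'1 [i1 h1]; have [i2 h2] := pass_cmdP i1; split=> //.
  case: h2 => [[h2 [u hu]]|[h2 h3]].
    by left; case: h1 => [h1|/(_ u)]; [lia|rewrite (negPf hu)].
  by right=> u; rewrite /inactive /state_left /state_price !h2; exact: h3.
split=> //; case: H => // H.
have : total_price n st' <= n * n.+1.
  rewrite -[X in X * _]card_ord -sum_nat_const; apply: leq_sum => v _.
  by case: inv' => _ [_ ainv]; exact: inv_bound ainv v.
by nia.
Qed.

(** Variable 19 already holds [#|near e s|], so it ends as the left-hand side of the test in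
    [auction_decides]. *)
Definition count_cmd := CFor 6 (CLoad 9 3 6 ;; CIf 9 (CAdd 19 19 18) CSkip).

Lemma count_cmdP n st : vars st 1 = n -> vars st 18 = 1 ->
  vars (exec count_cmd st) 19 = vars st 19 + #|[set u : 'I_n | state_left st u]|.
Proof.
move=> s1 s18.
have [||||s' [-> _ inv]] := @exec_for (CLoad 9 3 6 ;; CIf 9 (CAdd 19 19 18) CSkip) 6 st
  (fun k s' => vars s' 19 = vars st 19 + \sum_(0 <= x < k) (arrs st 3 x != 0)) => //.
- by rewrite big_geq // addn0.
- rewrite s1 => k s' hk [fv fa] h; rewrite exec_seq /= /upd /= fa //.
  rewrite big_nat_recr //= addnA -h; case: eqP => _ /=; rewrite /upd /= ?addn0 //.
  by rewrite (fv 18) // s18.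
rewrite /= /upd /= inv s1 big_mkord; congr (_ + _).
rewrite -sum1_card [RHS]big_mkcond; apply: eq_bigr => u _.
by rewrite inE /state_left; case: ifP.
Qed.

(** Array 0 holds [ball1], which agrees with adjacency at distinct [s] and [t]. The truncated
    difference vanishes iff the count is at most [k + n]. *)
Definition finish_cmd :=
  load2 9 0 2 3 ;;
  CIf 9 (CConst 0 0)
    (CAdd 10 4 1 ;; CSub 11 19 10 ;; CIf 11 (CConst 0 0) (CConst 0 1)).

Definition secluded_cmd :=
  diag_cmd ;; prod_cmd 0 0 1 ;; prod_cmd 1 0 2 ;; init_cmd ;; rounds_cmd ;;
  count_cmd ;; finish_cmd.

Lemma init_inv n (e : rel 'I_n) (s t : 'I_n) st :
  vars st 1 = n -> vars st 2 = s -> vars st 3 = t ->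
  rep st 1 (ball2 e) -> rep st 2 (ball3 e) -> state_inv e s t (exec init_cmd st).
Proof.
move=> s1 s2 s3 h1 h2; have [i18 i20 i21 _ hv] := init_cmdP s1 s2 s3 h1.
have hl v : state_left (exec init_cmd st) v = (v \in near e t).
  by rewrite /state_left; have [-> _ _] := hv v; case: (v \in _).
have hr v : @state_right n (exec init_cmd st) v = 0 by have [] := hv v.
have hp v : @state_price n (exec init_cmd st) v = if v \in near e s then n.+1 else 0.
  by have [] := hv v.
split; first by rewrite exec_vars.
split; first by rewrite /rep exec_arrs.
split=> [u v|u v w|v w|u|u|v vs|v|v vs _|v]; rewrite ?hl ?hr ?hp //.
- by left.
- by rewrite vs.
- by case: ifP.
- by rewrite (negPf vs).
Qed.

Lemma secluded_cmdP n (e : rel 'I_n) (s t : 'I_n) k st :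
  symmetric e -> irreflexive e -> s != t ->
  [/\ vars st 1 = n, vars st 2 = s, vars st 3 = t & vars st 4 = k] ->
  (forall i j : 'I_n, i != j -> arrs st 0 (i * n + j) = e i j) ->
  vars (exec secluded_cmd st) 0 = 1 <-> secluded_st_separator e s t k.
Proof.
move=> e_sym e_irr st_ne [h1 h2 h3 h4] hE.
have n2 : 1 < n.
  by move: st_ne; rewrite -val_eqE /=; have := ltn_ord s; have := ltn_ord t; lia.
rewrite /secluded_cmd 6!exec_seq.
have r0 := diag_cmdP h1 hE e_irr.
set s1 := exec diag_cmd st in r0 *.
have f1 r : r \in [:: 1; 2; 3; 4] -> vars s1 r = vars st r by exact: exec_vars_in.
have r1 := @prod_cmdP n _ _ 0 0 1 s1 isT isT (etrans (f1 1 isT) h1) r0 r0.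
set s2 := exec (prod_cmd 0 0 1) s1 in r1 *.
have f2 r : r \in [:: 1; 2; 3; 4] -> vars s2 r = vars st r.
  by move=> hr; transitivity (vars s1 r); [exact: exec_vars_in hr | exact: f1].
have r0' : rep s2 0 (ball1 e) by rewrite /rep exec_arrs.
have r2 := @prod_cmdP n _ _ 1 0 2 s2 isT isT (etrans (f2 1 isT) h1) r1 r0'.
set s3 := exec (prod_cmd 1 0 2) s2 in r2 *.
have f3 r : r \in [:: 1; 2; 3; 4] -> vars s3 r = vars st r.
  by move=> hr; transitivity (vars s2 r); [exact: exec_vars_in hr | exact: f2].
have r0'' : rep s3 0 (ball1 e) by rewrite /rep exec_arrs.
have r1' : rep s3 1 (ball2 e) by rewrite /rep exec_arrs.
have [g1 g2 g3 g4] : [/\ vars s3 1 = n, vars s3 2 = s, vars s3 3 = t & vars s3 4 = k].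
  by rewrite !f3.
have inv4 := init_inv g1 g2 g3 r1' r2.
have [_ _ _ c19 _] := init_cmdP g1 g2 g3 r1'.
have [inv5 fin] := rounds_cmdP n2 inv4.
set s4 := exec init_cmd s3 in inv4 c19 inv5 fin *.
set s5 := exec rounds_cmd s4 in inv5 fin *.
have [[i1 i18 _ _] [_ ainv]] := inv5.
have c6 := count_cmdP i1 i18.
set s6 := exec count_cmd s5 in c6 *.
have keep r : r \in [:: 1; 2; 3; 4] -> vars s6 r = vars s3 r.
  move=> hr; transitivity (vars s5 r); first exact: exec_vars_in hr.
  by transitivity (vars s4 r); exact: exec_vars_in hr.
have c19' : vars s5 19 = #|near e s| by rewrite /s5 exec_vars.
have r6 : rep s6 0 (ball1 e).
  suff a6 : arrs s6 0 = arrs s3 0 by rewrite /rep a6.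
  transitivity (arrs s5 0); first exact: exec_arrs.
  by transitivity (arrs s4 0); exact: exec_arrs.
clearbody s6; clearbody s5.
apply: (iff_trans _ (iff_sym (auction_decides k e_sym st_ne ainv _))); last first.
  move=> u v uM uv; have := fin u.
  rewrite /inactive (negPf uM) [false || _]/= => /forallP/(_ v).
  by rewrite uv.
rewrite /finish_cmd exec_seq.
have [] := @load2P 9 0 2 3 s6 isT isT; move: (exec _ s6) => s7 v7 f7 _.
have e9 : vars s7 9 = e s t.
  by rewrite v7 !keep // g1 g2 g3 r6 /ball1 /= (negPf st_ne).
rewrite /= e9; case: (e s t) => /=; first by split=> // -[].
rewrite /upd /= !f7 // (keep 1) // (keep 4) // g1 g4 c6 c19' addnC.
rewrite subn_eq0; case: leqP => h /=; rewrite /upd /=; split=> //.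
by case.
Qed.

Theorem theorem1 :
  exists (p : program) (c d : nat), decides_secluded_in_poly_time p c d.
Proof.
apply: (@ram_decides secluded_cmd) => //.
by move=> *; apply: secluded_cmdP.
Qed.
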